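(* Let $d=(d_1,\dots,d_t)$ be a dimension vector, $l\ge 0$ with $l<t$, and $x\in\mathfrak p_u^{(l)}(d)$. Then the codimension of the orbit $P(d)\cdot x$ in $\mathfrak p_u^{(l)}(d)$ equals $\dim_k\mathrm{Ext}^1_{\mathcal A_{t,l}}(M(x),M(x))$. In particular, $P(d)\cdot x$ is dense in $\mathfrak p_u^{(l)}(d)$ if and only if $\mathrm{Ext}^1_{\mathcal A_{t,l}}(M(x),M(x))=0$.
   Context: Let $k$ be an algebraically closed field. A dimension vector is $d=(d_1,\dots,d_t)\in\mathbb Z_{\ge0}^t$; put $(\Sigma d)_i=d_1+\dots+d_i$ and $n=(\Sigma d)_t$. The standard flag is $0=V_0\subseteq V_1\subseteq\dots\subseteq V_t=k^n$ with $V_i=k^{(\Sigma d)_i}$ (spanned by the first $(\Sigma d)_i$ standard basis vectors). $P(d)\subseteq\mathrm{GL}_n(k)$ is the stabilizer of this flag, acting by conjugation on $\mathfrak p_u^{(l)}(d)=\{f\in\mathrm{End}(k^n): f(V_i)\subseteq V_{i-l-1}\text{ for all } i\}$ (with $V_j=0$ for $j\le 0$). The algebra $\mathcal A_{t,l}$ is the quotient of the path algebra over $k$ of the quiver with vertices $1,\dots,t$, arrows $\alpha_i:i\to i+1$ ($1\le i\le t-1$) and $\beta_j:j+l+1\to j$ ($1\le j\le t-l-1$), by the relations $\beta_1\alpha_{l+1}=0$ and $\beta_{i+1}\alpha_{i+l+1}=\alpha_i\beta_i$ for $1\le i\le t-l-2$ (compositions of linear maps, right to left); modules are identified with representations satisfying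 these relations. For $x\in\mathfrak p_u^{(l)}(d)$, $M(x)$ is the $\mathcal A_{t,l}$-module with $M(x)_i=V_i$, $\alpha_i$ the inclusion $V_i\hookrightarrow V_{i+1}$, and $\beta_j$ the restriction of $x$ to $V_{j+l+1}$, viewed as a map $V_{j+l+1}\to V_j$. *)

(* Defs.v *)
From HB Require Import structures.
From mathcomp Require Import all_boot all_order all_algebra.
From mathcomp Require Import mpoly.
Set Implicit Arguments. Unset Strict Implicit. Unset Printing Implicit Defensive.
Import GRing.Theory.
Local Open Scope ring_scope.

(* V_i = span of the first (psum d i) standard basis vectors of k^n.         *)
(* Matrices act on COLUMN vectors: f(e_c) = sum_r A r c e_r.                 *)

Definition psum (d : seq nat) (i : nat) : nat := (\sum_(j < i) nth 0 d j)%N.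
Definition nsum (d : seq nat) : nat := psum d (size d).

Section Flag.
Variables (K : fieldType) (d : seq nat).
Local Notation n := (nsum d).

(* A(V_i) \subseteq V_j  (with V_0 = 0) *)
Definition maps_into (A : 'M[K]_n) (i j : nat) : Prop :=
  forall r c : 'I_n, (c < psum d i)%N -> (psum d j <= r)%N -> A r c = 0.

Definition parabolic (g : 'M[K]_n) : Prop :=
  g \in unitmx /\ forall i, (i <= size d)%N -> maps_into g i i.

(* p_u^{(l)}(d) : f(V_i) \subseteq V_{i-l-1}, V_j = 0 for j <= 0
   (truncated subtraction i - l.+1 = 0 gives V_0 = 0). *)
Definition pu (l : nat) (f : 'M[K]_n) : Prop :=
  forall i, (i <= size d)%N -> maps_into f i (i - l.+1).

Definition Porbit (x : 'M[K]_n) (y : 'M[K]_n) : Prop :=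
  exists g, parabolic g /\ y = g *m x *m invmx g.

End Flag.

Section Zariski.
Variables (K : fieldType) (n : nat).
Local Notation mx := ('M[K]_n).

Definition mx_eval (p : {mpoly K[n * n]}) (A : mx) : K :=
  p.@[fun i => mxvec A ord0 i].

Definition zclosed (Z : mx -> Prop) : Prop :=
  exists F : {mpoly K[n * n]} -> Prop,
    forall A, Z A <-> (forall p, F p -> mx_eval p A = 0).

Definition zclosure (S : mx -> Prop) (A : mx) : Prop :=
  forall p : {mpoly K[n * n]}, (forall B, S B -> mx_eval p B = 0) -> mx_eval p A = 0.

Definition zsubset (Z1 Z2 : mx -> Prop) : Prop := forall A, Z1 A -> Z2 A.

Definition zirreducible (Z : mx -> Prop) : Prop :=
  [/\ zclosed Z, exists A, Z A &
      forall Z1 Z2, zclosed Z1 -> zclosed Z2 ->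
        (forall A, Z A -> Z1 A \/ Z2 A) -> zsubset Z Z1 \/ zsubset Z Z2].

Definition zchain (S : mx -> Prop) (m : nat) : Prop :=
  exists c : nat -> mx -> Prop,
    [/\ forall i, (i <= m)%N -> zirreducible (c i),
        forall i, (i < m)%N -> zsubset (c i) (c i.+1) /\ ~ zsubset (c i.+1) (c i)
      & zsubset (c m) (zclosure S)].

Definition zdim (S : mx -> Prop) (m : nat) : Prop :=
  zchain S m /\ ~ zchain S m.+1.

(* S is dense in T (S \subseteq T) : T lies in the Zariski closure of S *)
Definition zdense (S T : mx -> Prop) : Prop := forall A, T A -> zclosure S A.

End Zariski.

(* Representations of A_{t,l}: vertices 1..t, alpha_i : i -> i+1            *)
(* (1 <= i <= t-1), beta_j : j+l+1 -> j (1 <= j <= t-l-1).                   *)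
(* Components at indices outside these ranges are irrelevant junk.          *)
Section Reps.
Variables (K : fieldType) (t l : nat).

Record rep := Rep {
  dv : nat -> nat;
  ra : forall i, 'M[K]_(dv i.+1, dv i);
  rb : forall j, 'M[K]_(dv j, dv (j + l.+1)) }.

Definition is_rep (M : rep) : Prop :=
  ((l.+2 <= t)%N -> rb M 1 *m ra M l.+1 = 0) /\
  (forall i, (1 <= i)%N -> (i + l.+2 <= t)%N ->
     rb M i.+1 *m ra M (i + l.+1) = ra M i *m rb M i).

Record cochain (N M : rep) := Cochain {
  ca : forall i, 'M[K]_(dv N i.+1, dv M i);
  cb : forall j, 'M[K]_(dv N j, dv M (j + l.+1)) }.

(* the representation E(f) with E_i = N_i (+) M_i and arrows
   [[N_a, f_a], [0, M_a]] ; it is an extension 0 -> N -> E(f) -> M -> 0 *)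
Definition ext_rep (N M : rep) (f : cochain N M) : rep :=
  @Rep (fun i => (dv N i + dv M i)%N)
       (fun i => block_mx (ra N i) (ca f i) 0 (ra M i))
       (fun j => block_mx (rb N j) (cb f j) 0 (rb M j)).

Definition cocycle (N M : rep) (f : cochain N M) : Prop := is_rep (ext_rep f).

(* the extension E(f) is equivalent to the split one *)
Definition coboundary (N M : rep) (f : cochain N M) : Prop :=
  exists h : forall i, 'M[K]_(dv N i, dv M i),
    (forall i, (1 <= i)%N -> (i.+1 <= t)%N ->
       ca f i = ra N i *m h i - h i.+1 *m ra M i) /\
    (forall j, (1 <= j)%N -> (j + l.+1 <= t)%N ->
       cb f j = rb N j *m h (j + l.+1) - h j *m rb M j).

Definition lincomb (N M : rep) (e : nat) (c : 'I_e -> K)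
    (f : 'I_e -> cochain N M) : cochain N M :=
  @Cochain N M (fun i => \sum_(k < e) c k *: ca (f k) i)
               (fun j => \sum_(k < e) c k *: cb (f k) j).

(* dim_K Ext^1(M, N) = e, where Ext^1(M,N) = {cocycles} / {coboundaries}
   (Yoneda extensions up to equivalence, with the vector space structure
   induced from cochains). *)
Definition ext1_dim (M N : rep) (e : nat) : Prop :=
  (exists f : 'I_e -> cochain N M,
     (forall k, cocycle (f k)) /\
     (forall c : 'I_e -> K, coboundary (lincomb c f) -> forall k, c k = 0)) /\
  (forall f : 'I_e.+1 -> cochain N M, (forall k, cocycle (f k)) ->
     exists c : 'I_e.+1 -> K, (exists k, c k != 0) /\ coboundary (lincomb c f)).

End Reps.

Definition mxfun (K : fieldType) (n : nat) (x : 'M[K]_n) (r c : nat) : K :=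
  match (insub r : option 'I_n), (insub c : option 'I_n) with
  | Some r', Some c' => x r' c'
  | _, _ => 0
  end.

(* M(x)_i = V_i = K^(psum d i); alpha_i the inclusion V_i -> V_{i+1};
   beta_j = x restricted to V_{j+l+1}, as a map to V_j *)
Definition Mx (K : fieldType) (l : nat) (d : seq nat) (x : 'M[K]_(nsum d)) : rep K l :=
  @Rep K l (psum d)
    (fun i => \matrix_(r < psum d i.+1, c < psum d i) ((r : nat) == c)%:R)
    (fun j => \matrix_(r < psum d j, c < psum d (j + l.+1)) mxfun x r c).

Arguments maps_into {K} d A i j.
Arguments parabolic {K} d g.
Arguments pu {K} d l f.
Arguments Porbit {K} d x y.
Arguments Mx {K} l d x.

(* Main.v *)
Require Import Defs.
From HB Require Import structures.
From mathcomp Require Import all_boot all_order all_algebra.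
From mathcomp Require Import mpoly.
From mathcomp Require Import ring.
From Stdlib Require Import Classical.

(** Every self-extension of [M(x)] is equivalent to one that changes only the
    [beta_j], because the [alpha_i] are split injective; such an extension is
    given by some [y] in [p_u^(l)], and it splits iff [y = [g, x]] with [g] in
    the Lie algebra [p] of [P(d)].  Hence [Ext^1(M(x), M(x))] is the quotient
    of [p_u^(l)] by [W = [p, x]], and it remains to show that the orbit of [x]
    has dimension [r = dim W] in every characteristic.

    Write [p = C + L] with [C] the centralizer of [x] in [p] and [dim L = r].
    The orbit has the same closure as the [r]-parameter family
    [phi(h) = h x h^-1], [h] in [1 + L], since a generic [g] in [P(d)] has a
    multiple [g c], [c] in [C], lying in [1 + L].  A chain of irreducible closed
    subsets of length [m] yields [m] algebraically independent polynomials,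
    while [r + 1] rational functions of [r] parameters are dependent, so chains
    have length at most [r].  The images under [phi] of a full flag of affine
    subspaces of [1 + L] form a chain of length [r]: its inclusions are strict
    because the differential of [phi] at [1], namely [e |-> [e, x]], is
    injective on [L]. *)

Set Implicit Arguments. Unset Strict Implicit. Unset Printing Implicit Defensive.
Import GRing.Theory.
Local Open Scope ring_scope.

(** * Algebras of functions *)

Section FunctionAlgebras.
Variable K : fieldType.

(** Invariance under pointwise equality is a separate clause because [P] is a predicate on functions
    and extensionality is not assumed. Polynomial functions and their localisations are handled
    uniformly as instances. *)
Definition fun_algebra (T : Type) (P : (T -> K) -> Prop) : Prop :=
  [/\ forall F G, F =1 G -> P F -> P G, forall c, P (fun=> c),
      forall F G, P F -> P G -> P (fun t => F t + G t)
    & forall F G, P F -> P G -> P (fun t => F t * G t)].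

Section Closure.
Variables (T : Type) (P : (T -> K) -> Prop).
Hypothesis algP : fun_algebra P.

Lemma fun_algebra_ext F G : F =1 G -> P F -> P G.
Proof. by case: algP => h _ _ _; apply: h. Qed.

Lemma fun_algebra_const c : P (fun=> c).
Proof. by case: algP. Qed.

Lemma fun_algebraD F G : P F -> P G -> P (fun t => F t + G t).
Proof. by case: algP => _ _ h _; apply: h. Qed.

Lemma fun_algebraM F G : P F -> P G -> P (fun t => F t * G t).
Proof. by case: algP => _ _ _; apply. Qed.

Lemma fun_algebra_sum (I : Type) (r : seq I) (Q : pred I) (F : I -> T -> K) :
  (forall i, Q i -> P (F i)) -> P (fun t => \sum_(i <- r | Q i) F i t).
Proof.
move=> hF; elim: r => [|i r IH].
  apply: (fun_algebra_ext (F := fun=> 0)); first by move=> t; rewrite big_nil.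
  exact: fun_algebra_const.
case Qi: (Q i).
  apply: (fun_algebra_ext (F := fun t => F i t + \sum_(j <- r | Q j) F j t)).
    by move=> t; rewrite big_cons Qi.
  by apply: fun_algebraD => //; apply: hF.
by apply: fun_algebra_ext IH => t; rewrite big_cons Qi.
Qed.

Lemma fun_algebra_prod (I : Type) (r : seq I) (F : I -> T -> K) :
  (forall i, P (F i)) -> P (fun t => \prod_(i <- r) F i t).
Proof.
move=> hF; elim: r => [|i r IH].
  apply: (fun_algebra_ext (F := fun=> 1)); first by move=> t; rewrite big_nil.
  exact: fun_algebra_const.
apply: (fun_algebra_ext (F := fun t => F i t * \prod_(j <- r) F j t)).
  by move=> t; rewrite big_cons.
exact: fun_algebraM.
Qed.

Lemma fun_algebraX F k : P F -> P (fun t => F t ^+ k).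
Proof.
move=> hF; apply: (fun_algebra_ext (F := fun t => \prod_(i < k) F t)).
  by move=> t; rewrite prodr_const card_ord.
exact: fun_algebra_prod.
Qed.

Lemma fun_algebra_meval m (F : 'I_m -> T -> K) (p : {mpoly K[m]}) :
  (forall i, P (F i)) -> P (fun t => p.@[F^~ t]).
Proof.
move=> hF; apply: (fun_algebra_ext
  (F := fun t => \sum_(a <- msupp p) p@_a * \prod_i F i t ^+ a i)).
  by move=> t; rewrite mevalE.
apply: fun_algebra_sum => a _; apply: fun_algebraM; first exact: fun_algebra_const.
by apply: fun_algebra_prod => i; apply: fun_algebraX.
Qed.

Definition mx_in m1 m2 (A : T -> 'M[K]_(m1, m2)) := forall i j, P (fun t => A t i j).

Lemma mx_in_const m1 m2 (A : 'M[K]_(m1, m2)) : mx_in (fun=> A).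
Proof. by move=> i j; apply: fun_algebra_const. Qed.

Lemma mx_in_mul m1 m2 m3 (A : T -> 'M[K]_(m1, m2)) (B : T -> 'M[K]_(m2, m3)) :
  mx_in A -> mx_in B -> mx_in (fun t => A t *m B t).
Proof.
move=> hA hB i j; apply: (fun_algebra_ext (F := fun t => \sum_k A t i k * B t k j)).
  by move=> t; rewrite mxE.
by apply: fun_algebra_sum => k _; apply: fun_algebraM.
Qed.

Lemma mx_in_add m1 m2 (A B : T -> 'M[K]_(m1, m2)) :
  mx_in A -> mx_in B -> mx_in (fun t => A t + B t).
Proof.
move=> hA hB i j; apply: (fun_algebra_ext (F := fun t => A t i j + B t i j)).
  by move=> t; rewrite mxE.
exact: fun_algebraD.
Qed.

Lemma mx_in_scale m1 m2 (a : T -> K) (A : T -> 'M[K]_(m1, m2)) :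
  P a -> mx_in A -> mx_in (fun t => a t *: A t).
Proof.
move=> ha hA i j; apply: (fun_algebra_ext (F := fun t => a t * A t i j)).
  by move=> t; rewrite mxE.
exact: fun_algebraM.
Qed.

Lemma mx_in_sum m1 m2 (I : Type) (r : seq I) (A : I -> T -> 'M[K]_(m1, m2)) :
  (forall k, mx_in (A k)) -> mx_in (fun t => \sum_(k <- r) A k t).
Proof.
move=> hA i j; apply: (fun_algebra_ext (F := fun t => \sum_(k <- r) A k t i j)).
  by move=> t; rewrite summxE.
by apply: fun_algebra_sum => k _; apply: hA.
Qed.

Lemma fun_algebra_det m (A : T -> 'M[K]_m) : mx_in A -> P (fun t => \det (A t)).
Proof.
move=> hA; rewrite /determinant.
apply: fun_algebra_sum => s _.
apply: fun_algebraM; first exact: fun_algebra_const.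
by apply: fun_algebra_prod => i.
Qed.

Lemma mx_in_adj m (A : T -> 'M[K]_m) : mx_in A -> mx_in (fun t => \adj (A t)).
Proof.
move=> hA i j; apply: (fun_algebra_ext (F := fun t =>
  (-1) ^+ (j + i) * \det (row' j (col' i (A t))))).
  by move=> t; rewrite mxE.
apply: fun_algebraM; first exact: fun_algebra_const.
apply: fun_algebra_det => k l.
by apply: fun_algebra_ext (hA (lift j k) (lift i l)) => t; rewrite !mxE.
Qed.

Lemma mx_in_vec m1 m2 (A : T -> 'M[K]_(m1, m2)) :
  mx_in A -> mx_in (fun t => mxvec (A t)).
Proof.
move=> hA i j; case/mxvec_indexP: j => a b.
by apply: fun_algebra_ext (hA a b) => t; rewrite ord1 mxvecE.
Qed.

Lemma mx_in_unvec m1 m2 (A : T -> 'rV[K]_(m1 * m2)) :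
  mx_in A -> mx_in (fun t => vec_mx (A t)).
Proof.
move=> hA i j.
by apply: fun_algebra_ext (hA 0 (mxvec_index i j)) => t; rewrite mxE.
Qed.

Lemma fun_algebra_mx_eval m (p : {mpoly K[m * m]}) (A : T -> 'M[K]_m) :
  mx_in A -> P (fun t => mx_eval p (A t)).
Proof. by move=> hA; apply: fun_algebra_meval => i; apply: mx_in_vec. Qed.

(* The localisation of the algebra [P] at [D], as functions that are only
   meaningful where [D] does not vanish. *)
Definition localized (D : T -> K) (F : T -> K) : Prop :=
  exists G k, P G /\ forall t, D t != 0 -> F t * D t ^+ k = G t.

Lemma localized_algebra D : P D -> fun_algebra (localized D).
Proof.
move=> hD; split=> [F G eFG [H [k [hH e]]]|c|F G|F G].
- by exists H, k; split=> // t; rewrite -eFG; apply: e.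
- exists (fun=> c), 0%N; split; first exact: fun_algebra_const.
  by move=> t _; rewrite mulr1.
- move=> [H [k [hH e]]] [H' [k' [hH' e']]].
  exists (fun t => H t * D t ^+ k' + H' t * D t ^+ k), (k + k')%N; split.
    by apply: fun_algebraD; apply: fun_algebraM => //; apply: fun_algebraX.
  move=> t Dt; rewrite -e // -e' // mulrDl -!mulrA -!exprD.
  by rewrite (addnC k').
move=> [H [k [hH e]]] [H' [k' [hH' e']]].
exists (fun t => H t * H' t), (k + k')%N; split; first exact: fun_algebraM.
by move=> t Dt; rewrite -e // -e' // exprD mulrACA.
Qed.

Lemma localizedW D F : P F -> localized D F.
Proof. by move=> hF; exists F, 0%N; split=> // t _; rewrite mulr1. Qed.

Lemma localizedV D : localized D (fun t => (D t)^-1).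
Proof.
exists (fun=> 1), 1%N; split; first exact: fun_algebra_const.
by move=> t Dt; rewrite expr1 mulVf.
Qed.

End Closure.

Lemma mx_in_localizedW T (P : (T -> K) -> Prop) D m1 m2 (A : T -> 'M[K]_(m1, m2)) :
  mx_in P A -> mx_in (localized P D) A.
Proof. by move=> hA i j; apply: localizedW. Qed.

Lemma mx_in_localized_ext T (P : (T -> K) -> Prop) D m1 m2
    (A B : T -> 'M[K]_(m1, m2)) :
  (forall t, D t != 0 -> A t = B t) ->
  mx_in (localized P D) A -> mx_in (localized P D) B.
Proof.
move=> eAB hA i j; have [G [k [hG e]]] := hA i j.
by exists G, k; split=> // t Dt; rewrite -eAB // e.
Qed.

(** Cramer's formula gives the inverse only where the determinant is nonzero, and these are exactly
    the points where [localized] imposes a condition. *)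
Lemma mx_in_inv T (P : (T -> K) -> Prop) m (A : T -> 'M[K]_m) :
  fun_algebra P -> mx_in P A ->
  mx_in (localized P (fun t => \det (A t))) (fun t => invmx (A t)).
Proof.
move=> algP hA; have hD := fun_algebra_det algP hA.
apply: (mx_in_localized_ext (A := fun t => (\det (A t))^-1 *: \adj (A t))).
  by move=> t Dt; rewrite /invmx unitmxE unitfE Dt.
apply: mx_in_scale; [exact: localized_algebra|exact: localizedV|].
by apply: mx_in_localizedW; apply: mx_in_adj.
Qed.

Definition polyfun r (F : 'rV[K]_r -> K) : Prop :=
  exists p : {mpoly K[r]}, forall u, F u = p.@[u ord0].

Lemma polyfun_algebra r : fun_algebra (@polyfun r).
Proof.
split=> [F G eFG [p e]|c|F G [p e] [q e']|F G [p e] [q e']].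
- by exists p => u; rewrite -eFG.
- by exists c%:MP => u; rewrite mevalC.
- by exists (p + q) => u; rewrite mevalD e e'.
- by exists (p * q) => u; rewrite mevalM e e'.
Qed.

Lemma polyfun_coord r (j : 'I_r) : polyfun (fun u => u ord0 j).
Proof. by exists 'X_j => u; rewrite mevalXU. Qed.

Definition upolyfun (F : K -> K) : Prop := exists p : {poly K}, forall s, F s = p.[s].

Lemma upolyfun_algebra : fun_algebra upolyfun.
Proof.
split=> [F G eFG [p e]|c|F G [p e] [q e']|F G [p e] [q e']].
- by exists p => u; rewrite -eFG.
- by exists c%:P => u; rewrite hornerC.
- by exists (p + q) => u; rewrite hornerD e e'.
- by exists (p * q) => u; rewrite hornerM e e'.
Qed.

Lemma upolyfun_id : upolyfun id.
Proof. by exists 'X => s; rewrite hornerX. Qed.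

Lemma polyfun_comp T (P : (T -> K) -> Prop) r (c : T -> 'rV[K]_r) F :
  fun_algebra P -> mx_in P c -> polyfun F -> P (fun t => F (c t)).
Proof.
move=> algP hc [p e].
apply: (fun_algebra_ext algP (F := fun t => p.@[c t ord0])) => //.
by apply: fun_algebra_meval => // i; apply: hc.
Qed.

Lemma localized_comp T (P : (T -> K) -> Prop) r (c : T -> 'rV[K]_r) D F :
  fun_algebra P -> mx_in P c ->
  localized (@polyfun r) D F -> localized P (fun t => D (c t)) (fun t => F (c t)).
Proof.
move=> algP hc [G [k [hG e]]]; exists (fun t => G (c t)), k.
by split=> [|t]; [exact: (polyfun_comp algP hc hG)|apply: e].
Qed.

End FunctionAlgebras.

(** * Non-vanishing of polynomials over an algebraically closed field *)

Section ClosedField.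
Variable K : closedFieldType.

Lemma upolyfun_nonzero_ex (F : K -> K) s0 (G : K -> K) s1 :
  upolyfun F -> upolyfun G -> F s0 != 0 -> G s1 != 0 ->
  exists s, F s * G s != 0.
Proof.
move=> [p e] [q e'] nF nG.
have p0 : p != 0 by apply: contraNneq nF => p0; rewrite e p0 horner0.
have q0 : q != 0 by apply: contraNneq nG => q0; rewrite e' q0 horner0.
have /closed_nonrootP[s] : p * q != 0 by rewrite mulf_neq0.
by rewrite /root hornerM -e -e' => h; exists s.
Qed.

(** A polynomial identity extends from the dense open set where [F] is nonzero to the whole line. *)
Lemma upolyfun_eq0 (F : K -> K) s0 (G : K -> K) :
  upolyfun F -> upolyfun G -> F s0 != 0 -> (forall s, F s != 0 -> G s = 0) ->
  forall s, G s = 0.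
Proof.
move=> hF hG nF h s; apply/eqP/negPn/negP => nG.
have [s' /negP[]] := upolyfun_nonzero_ex hF hG nF nG.
by rewrite mulf_eq0; case: eqVneq => //= /h ->.
Qed.

(** [muni] regards [p] as a polynomial in its last variable over the polynomials in the others;
    comparing coefficients shows that no information is lost. *)
Lemma muni_coef n (p : {mpoly K[n.+1]}) (a : 'X_{1..n.+1}) :
  (muni p)`_(a ord_max)@_[multinom a (widen_ord (leqnSn n) i) | i < n] = p@_a.
Proof.
rewrite muniE coef_sum raddf_sum /= [in RHS](mpolyE p) raddf_sum /=.
apply: eq_bigr => b _; rewrite coefZ coefXn mulr_natr raddfMn /= !mcoeffZ !mcoeffX.
rewrite -mulrnAr -mulrnA mulnb; congr (_ * _%:R); congr nat_of_bool.
apply/andP/eqP => [[/eqP e1 /eqP e2]|->]; last by rewrite !eqxx.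
apply/mnmP => i; case: (unliftP ord_max i) => [j ->|-> //].
have := congr1 (fun x : 'X_{1..n} => x j) e1; rewrite !mnmE.
by have -> : widen_ord (leqnSn n) j = lift ord_max j by apply/val_inj; rewrite /= /bump leqNgt ltn_ord.
Qed.

Lemma meval_muni n (p : {mpoly K[n.+1]}) (v : 'I_n.+1 -> K) :
  p.@[v] = (map_poly (meval (v \o widen_ord (leqnSn n))) (muni p)).[v ord_max].
Proof.
rewrite muniE rmorph_sum /= horner_sum {1}(mpolyE p) raddf_sum /=.
apply: eq_bigr => b _.
rewrite map_polyZ /= hornerZ map_polyXn hornerXn !mevalZ !mevalX -mulrA.
rewrite big_ord_recr /=; congr (_ * (_ * _)).
by apply: eq_bigr => i _; rewrite mnmE.
Qed.

Lemma muni_eq0 n (p : {mpoly K[n.+1]}) : muni p = 0 -> p = 0.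
Proof. by move=> e; apply/mpolyP => a; rewrite -muni_coef e coef0 !mcoeff0. Qed.

(** Induction on the number of variables: take a point where the leading coefficient in the last
    variable is nonzero, then a non-root of the univariate polynomial obtained there. *)
Lemma mpoly_nonroot n (p : {mpoly K[n]}) : p != 0 -> exists v : 'rV_n, p.@[v ord0] != 0.
Proof.
elim: n p => [|n IH] p p0.
  exists 0; apply: contraNneq p0 => e; apply/eqP/mpolyP => a.
  move: e; rewrite [p]mpolyE raddf_sum /= mcoeff0 raddf_sum /= => e.
  rewrite -[RHS]e; apply: eq_bigr => b _; rewrite mevalZ mevalX big_ord0 mcoeffZ mcoeffX.
  by rewrite (_ : b = a) ?eqxx //; apply/mnmP; case.
have : muni p != 0 by apply: contraNneq p0 => /muni_eq0 ->.
rewrite -lead_coef_eq0 lead_coefE => /IH[v nv].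
have /closed_nonrootP[s] : map_poly (meval (v ord0)) (muni p) != 0.
  by apply: contraNneq nv => e; rewrite -coef_map /= e coef0.
rewrite /root => ns.
exists (\row_j if unlift ord_max j is Some k then v ord0 k else s).
rewrite meval_muni mxE unlift_none.
rewrite (_ : map_poly _ _ = map_poly (meval (v ord0)) (muni p)) //.
apply: eq_map_poly => q; apply: meval_eq => j /=; rewrite mxE.
have -> : widen_ord (leqnSn n) j = lift ord_max j by apply/val_inj; rewrite /= /bump leqNgt ltn_ord.
by rewrite liftK.
Qed.

End ClosedField.

(** * Algebraic independence and chains *)

Section AlgebraicIndependence.
Variables (K : closedFieldType) (n : nat).
Local Notation mx := ('M[K]_n).
Implicit Types (S Z : mx -> Prop).

Lemma zclosure_closed S : zclosed (zclosure S).
Proof.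
by exists (fun p => forall B, S B -> mx_eval p B = 0) => A; split=> h p /h.
Qed.

Lemma sub_zclosure S : zsubset S (zclosure S).
Proof. by move=> A SA p; apply. Qed.

Lemma zclosure_sub S Z : zsubset S (zclosure Z) -> zsubset (zclosure S) (zclosure Z).
Proof. by move=> h A SA p Zp; apply: SA => B /h; apply. Qed.

Definition alg_indep m (f : 'I_m -> {mpoly K[n * n]}) Z : Prop :=
  forall Q : {mpoly K[m]},
    (forall A, Z A -> Q.@[fun i => mx_eval (f i) A] = 0) -> Q = 0.

Lemma alg_indepS m (f : 'I_m -> {mpoly K[n * n]}) Z Z' :
  zsubset Z Z' -> alg_indep f Z -> alg_indep f Z'.
Proof. by move=> sZ indf Q hQ; apply: indf => A /sZ; apply: hQ. Qed.

(** The vanishing ideal of an irreducible set is prime: the zero sets of [p] and [q] are closed and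
    cover [Z]. *)
Lemma zirreducible_prime Z (p q : {mpoly K[n * n]}) :
  zirreducible Z -> (forall A, Z A -> mx_eval p A * mx_eval q A = 0) ->
  (forall A, Z A -> mx_eval p A = 0) \/ (forall A, Z A -> mx_eval q A = 0).
Proof.
move=> [_ _ irr] h.
have closed1 (g : {mpoly K[n * n]}) : zclosed (fun A => mx_eval g A = 0).
  by exists (fun g' => g' = g) => A; split=> [e g' ->|]; [|apply].
apply: (irr _ _ (closed1 p) (closed1 q)) => A /h /eqP.
by rewrite mulf_eq0 => /orP[] /eqP; [left|right].
Qed.

(* A function [p] vanishing on [Z1] but not on [Z2] is independent on [Z2] of
   the functions independent on [Z1]: after division by a power of [p], the
   constant term in [p] of a relation on [Z2] is a relation on [Z1]. *)
Lemma alg_indep_step m (f : 'I_m -> {mpoly K[n * n]}) Z1 Z2 :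
  zclosed Z1 -> zirreducible Z2 -> zsubset Z1 Z2 -> ~ zsubset Z2 Z1 ->
  alg_indep f Z1 -> exists g : 'I_m.+1 -> {mpoly K[n * n]}, alg_indep g Z2.
Proof.
move=> [F clF] irr2 s12 ns21 indf.
have [p pZ1 [A [Z2A pA]]] : exists2 p, (forall A, Z1 A -> mx_eval p A = 0) &
    exists A, Z2 A /\ mx_eval p A <> 0.
  apply: NNPP => no; apply: ns21 => A Z2A; apply/clF => p Fp.
  apply: NNPP => pA; apply: no; exists p; last by exists A.
  by move=> B /clF; apply.
exists (fun i => if unlift ord_max i is Some k then f k else p) => Q hQ.
apply: NNPP => Q0.
have {}Q0 : muni Q != 0 by apply/eqP => /muni_eq0.
(* Dividing by the largest power of the last variable leaves [q] whose constant term [q.[0]] is a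
   nonzero polynomial in the first [m] variables. *)
have [k [q]] := multiplicity_XsubC (muni Q) 0.
rewrite Q0 subr0 /= => q0 eQ.
pose G := (map_poly (comp_mpoly [tuple f i | i < m]) q).[p].
have GE B : mx_eval G B =
    (map_poly (meval (fun i => mx_eval (f i) B)) q).[mx_eval p B].
  rewrite /G /mx_eval -horner_map -map_poly_comp.
  congr (_.[_]); apply: eq_map_poly => c /=.
  by rewrite comp_mpoly_meval; apply: meval_eq => i; rewrite tnth_mktuple.
have QE B : Z2 B -> mx_eval (p ^+ k) B * mx_eval G B = 0.
  move=> /hQ; rewrite meval_muni unlift_none eQ rmorphM /= hornerM GE.
  rewrite map_polyXn hornerXn mulrC /mx_eval rmorphXn /= => e.
  rewrite -[RHS]e; congr (_ * _.[_]); apply: eq_map_poly => c; apply: meval_eq => i /=.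
  have -> : widen_ord (leqnSn m) i = lift ord_max i.
    by apply/val_inj; rewrite /= /bump leqNgt ltn_ord.
  by rewrite liftK.
have [h|h] := zirreducible_prime irr2 QE.
  by have /eqP := h A Z2A; rewrite /mx_eval rmorphXn expf_eq0 => /andP[_ /eqP].
(* On [Z1] the function [p] is zero, so [G] reduces to [q.[0]] evaluated at the [f i]: a nontrivial
   relation on [Z1]. *)
case/negP: q0; apply/eqP/indf => B Z1B.
by have := h B (s12 B Z1B); rewrite GE (pZ1 B Z1B) -[X in _.[X]](rmorph0 (meval (fun i => mx_eval (f i) B))) horner_map.
Qed.

(** Climbing the chain, each strict inclusion contributes one new independent function. *)
Lemma zchain_alg_indep S m :
  zchain S m -> exists f : 'I_m -> {mpoly K[n * n]}, alg_indep f (zclosure S).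
Proof.
move=> [c [irr lt sub]].
suff [f indf] : exists f : 'I_m -> {mpoly K[n * n]}, alg_indep f (c m).
  by exists f; apply: alg_indepS indf.
have: (m <= m)%N by [].
elim: {-2}m => [_|k IH ltkm]; last first.
  have [f indf] := IH (ltnW ltkm); have [s1 s2] := lt k ltkm.
  by apply: alg_indep_step indf => //; [have [] := irr k (ltnW ltkm)|apply: irr].
(* With no functions, independence only says that [c 0] has a point. *)
exists (fun=> 0) => Q hQ; have [_ [A cA] _] := irr 0%N isT.
apply/eqP; apply: contraT => /mpoly_nonroot[v /eqP[]].
by rewrite -(hQ A cA); apply: meval_eq; case.
Qed.

End AlgebraicIndependence.

Lemma wide_system_ker (K : fieldType) (I J : finType) (T : I -> J -> K) :
  (#|J| < #|I|)%N ->
  exists2 c : I -> K, (exists i, c i != 0) & forall j, \sum_i c i * T i j = 0.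
Proof.
move=> ltJI; pose A := \matrix_(i < #|I|, j < #|J|) T (enum_val i) (enum_val j).
have : kermx A != 0.
  rewrite kermx_eq0 /row_free; apply: contraTneq ltJI => <-.
  by rewrite -leqNgt rank_leq_col.
case/matrix0Pn => i0 [j0 nz].
exists (fun i => kermx A i0 (enum_rank i)).
  by exists (enum_val j0); rewrite enum_valK.
move=> j; have /matrixP/(_ i0 (enum_rank j)) := mulmx_ker A; rewrite !mxE => e.
rewrite -[RHS]e (reindex (@enum_val I predT)); last exact/onW_bij/enum_val_bij.
by apply: eq_bigr => k _; rewrite !mxE enum_valK enum_rankK.
Qed.

(** * Algebraic dependence by counting monomials *)

Section Counting.
Variable K : closedFieldType.

Lemma card_bmultinom r b : (#|{: 'X_{1..r < b}}| <= b ^ r)%N.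
Proof.
case: b => [|b].
  by rewrite (_ : #|_| = 0)%N //; apply: eq_card0 => -[m].
rewrite -[X in (_ <= X ^ _)%N]card_ord -[r in X in (_ <= X)%N]card_ord -card_ffun.
apply: (@leq_card _ _ (fun a : 'X_{1..r < b.+1} => [ffun i : 'I_r => inord (a i) : 'I_b.+1])).
move=> a a' /ffunP e; apply/val_inj/mnmP => i /=.
have lt (c : 'X_{1..r < b.+1}) : (c i < b.+1)%N.
  apply: leq_ltn_trans (bmdeg c); rewrite mdegE (bigD1 i) //=; exact: leq_addr.
by have := congr1 val (e i); rewrite !ffunE /= !inordK.
Qed.

(** [msize] is one more than the degree, and is [0] for the zero polynomial; bounds of the form
    [a.+1] cover both cases. *)
Lemma msizeM_bound r (p q : {mpoly K[r]}) a b :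
  (msize p <= a.+1 -> msize q <= b.+1 -> msize (p * q) <= (a + b).+1)%N.
Proof.
move=> hp hq; rewrite msizeE; apply/bigmax_leqP_seq => m /msuppM_le/allpairsP.
move=> [[m1 m2] [/= h1 h2 ->]] _; rewrite mdegD ltnS.
by apply: leq_add; rewrite -ltnS; [apply: leq_trans hp|apply: leq_trans hq];
   apply: msize_mdeg_lt.
Qed.

Lemma msizeX_bound r (p : {mpoly K[r]}) a k :
  (msize p <= a.+1 -> msize (p ^+ k) <= (k * a).+1)%N.
Proof.
move=> hp; elim: k => [|k IH]; first by rewrite expr0 msize1.
by rewrite exprS mulSn; apply: msizeM_bound.
Qed.

Lemma msize_prod_bound r m (p : 'I_m -> {mpoly K[r]}) a :
  (forall i, msize (p i) <= a.+1)%N -> (msize (\prod_i p i) <= (m * a).+1)%N.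
Proof.
move=> hp; elim: m p hp => [|m IH] p hp; first by rewrite big_ord0 msize1.
by rewrite big_ord_recl mulSn; apply: msizeM_bound => //; apply: IH.
Qed.

(* There are more monomials of multidegree below [N] in [r.+1] variables than
   polynomials in [r] variables of degree [O(N)] can keep independent. *)
Lemma localized_dependent r (D : 'rV[K]_r -> K) (f : 'I_r.+1 -> 'rV[K]_r -> K) :
  polyfun D -> (forall i, localized (@polyfun K r) D (f i)) ->
  exists2 Q : {mpoly K[r.+1]}, Q != 0 & forall u, D u != 0 -> Q.@[f^~ u] = 0.
Proof.
move=> [d dE] /fin_all_exists[G /fin_all_exists[k hG]].
pose k0 := (\sum_i k i)%N.
(* The exponent [k0] exceeds none of its summands' needs: being the sum of all [k i], it clears
   every denominator at once. *)
have [g gE] : exists g : 'I_r.+1 -> {mpoly K[r]}, forall i u, D u != 0 ->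
    f i u * (d ^+ k0).@[u ord0] = (g i).@[u ord0].
  apply: (@fin_all_exists _ _ (fun i gi => forall u, D u != 0 ->
    f i u * (d ^+ k0).@[u ord0] = gi.@[u ord0])) => i.
  have [[p pE] e] := hG i; exists (p * d ^+ (k0 - k i)) => u Du.
  have lek : (k i <= k0)%N by rewrite /k0 (bigD1 i) //= leq_addr.
  by rewrite rmorphM /= -pE -e // !rmorphXn /= -dE -mulrA -exprD subnKC.
set d' := d ^+ k0 in gE.
have d'0 u : D u != 0 -> d'.@[u ord0] != 0.
  by move=> Du; rewrite rmorphXn /= -dE expf_neq0.
clearbody d'.
(* [B] bounds the degrees of [d'] and of all [g i]. The choices give [M <= N * c] and [c ^ r < N],
   hence [M ^ r < N ^ r.+1]. *)
pose B := (msize d' + \sum_i msize (g i))%N.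
pose c := (r.+1 * B).+1; pose N := (c ^ r).+1.
pose M := (r.+1 * (N * B)).+1.
(* Where [D] is nonzero, [t a] is the monomial of exponent [a] in the [f i] times
   [d' ^+ (r.+1 * N)], a factor that does not depend on [a]. *)
pose t (a : {ffun 'I_r.+1 -> 'I_N}) : {mpoly K[r]} :=
  \prod_i (g i ^+ a i * d' ^+ (N - a i)).
have szt a : (msize (t a) <= M)%N.
  apply: msize_prod_bound => i.
  have -> : (N * B = a i * B + (N - a i) * B)%N.
    by rewrite -mulnDl subnKC // ltnW.
  apply: msizeM_bound; apply: msizeX_bound; apply: leqW; rewrite /B.
    by rewrite (bigD1 i) //= addnCA leq_addr.
  exact: leq_addr.
have powmono a b e : (a <= b -> a ^ e <= b ^ e)%N.
  by case: e => // e; rewrite leq_exp2r.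
have card_lt : (#|{: 'X_{1..r < M}}| < #|{ffun 'I_r.+1 -> 'I_N}|)%N.
  apply: leq_ltn_trans (card_bmultinom r M) _; rewrite card_ffun !card_ord.
  apply: (@leq_ltn_trans ((N * c) ^ r)%N).
    apply: powmono; rewrite /M /c mulnS mulnCA -add1n leq_add //.
  by rewrite expnMn expnSr ltn_pmul2l ?expn_gt0.
have [x [a0 xa0] xT] :=
  wide_system_ker (fun a (m : 'X_{1..r < M}) => (t a)@_m) card_lt.
pose mon (a : {ffun 'I_r.+1 -> 'I_N}) := [multinom (a i : nat) | i < r.+1].
have mon_inj : injective mon.
  move=> a b e; apply/ffunP => i; apply/val_inj.
  by have := congr1 (fun m : 'X_{1.._} => m i) e; rewrite !mnmE.
exists (\sum_a x a *: 'X_[mon a]).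
  apply: contraNneq xa0 => /(congr1 (mcoeff (mon a0))).
  rewrite mcoeff0 raddf_sum /= (bigD1 a0) //= mcoeffZ mcoeffX eqxx mulr1.
  rewrite big1 ?addr0 => [->//|b nb].
  by rewrite mcoeffZ mcoeffX (inj_eq mon_inj) (negbTE nb) mulr0.
move=> u Du; rewrite raddf_sum /=.
apply: (mulIf (expf_neq0 (r.+1 * N) (d'0 u Du))); rewrite mul0r mulr_suml.
transitivity ((\sum_a x a *: t a).@[u ord0]).
  rewrite raddf_sum /=; apply: eq_bigr => a _; rewrite !mevalZ mevalX -mulrA.
  congr (_ * _); rewrite rmorph_prod /= mulnC exprM.
  rewrite -[r.+1 in X in _ * X]card_ord -prodr_const -big_split /=.
  apply: eq_bigr => i _; rewrite mnmE rmorphM /= !rmorphXn /= -gE // exprMn -mulrA.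
  by rewrite -exprD subnKC // ltnW.
rewrite (_ : \sum_a _ = 0) ?meval0 //; apply/mpolyP => m.
(* Coefficients of degree below [M] vanish by the choice of [x]; in higher degree no [t a] has a
   term. *)
rewrite mcoeff0 raddf_sum /=; case: (ltnP (mdeg m) M) => [ltm|lem].
  rewrite -[RHS](xT (BMultinom ltm)); apply: eq_bigr => a _.
  by rewrite mcoeffZ.
apply: big1 => a _; rewrite mcoeffZ (_ : _@__ = 0) ?mulr0 //.
by apply/eqP; rewrite mcoeff_eq0; apply: msize_mdeg_ge; apply: leq_trans lem.
Qed.

End Counting.

(** * Dimension of a parametrized set *)

Section ParametrizedSets.
Variables (K : closedFieldType) (n : nat).
Local Notation mx := ('M[K]_n).

Definition param_image r (D : 'rV[K]_r -> K) (phi : 'rV[K]_r -> mx) : mx -> Prop :=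
  fun A => exists2 u, D u != 0 & A = phi u.

Lemma line_upolyfun m1 m2 (a b : 'M[K]_(m1, m2)) : mx_in (@upolyfun K) (fun s => a + s *: b).
Proof.
have alg := upolyfun_algebra K.
apply: (mx_in_add alg (A := fun=> a) (B := fun s => s *: b)); first exact: mx_in_const.
apply: (mx_in_scale alg (a := id) (A := fun=> b)); first exact: upolyfun_id.
exact: mx_in_const.
Qed.

(** If neither closed set contains the image, each is avoided at some parameter. On the line joining
    the two parameters, finitely many values are bad, so some point of the image avoids both
    sets. *)
Lemma param_image_irreducible r (D : 'rV[K]_r -> K) phi u0 :
  polyfun D -> mx_in (localized (@polyfun K r) D) phi -> D u0 != 0 ->
  zirreducible (zclosure (param_image D phi)).
Proof.
move=> hD hphi D0; have algU := upolyfun_algebra K; have algP := polyfun_algebra K r.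
split; first exact: zclosure_closed.
  by exists (phi u0); apply: sub_zclosure; exists u0.
move=> Z1 Z2 cl1 cl2 cover.
have outside Z : zclosed Z -> ~ zsubset (zclosure (param_image D phi)) Z ->
    exists p u, [/\ forall A, Z A -> mx_eval p A = 0, D u != 0
                  & mx_eval p (phi u) != 0].
  move=> [F clF] nsub; apply: NNPP => no; apply: nsub => A clA; apply/clF => p Fp.
  apply: clA => _ [u Du ->]; apply: NNPP => /eqP nz; apply: no; exists p, u.
  by split=> // B /clF; apply.
apply: NNPP => /not_or_and[/(outside _ cl1)[p1 [u1 [v1 D1 nz1]]]].
move=> /(outside _ cl2)[p2 [u2 [v2 D2 nz2]]].
pose line s := u1 + s *: (u2 - u1).
have line0 : line 0 = u1 by rewrite /line scale0r addr0.
have line1 : line 1 = u2 by rewrite /line scale1r addrC subrK.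
have hline : mx_in (@upolyfun K) line by apply: line_upolyfun.
have numerator p : exists G k, upolyfun G /\
    forall s, D (line s) != 0 -> mx_eval p (phi (line s)) * D (line s) ^+ k = G s.
  apply: (localized_comp algU hline (F := fun u => mx_eval p (phi u))).
  by apply: fun_algebra_mx_eval => //; apply: localized_algebra.
have [G1 [k1 [hG1 e1]]] := numerator p1; have [G2 [k2 [hG2 e2]]] := numerator p2.
have hDl : upolyfun (fun s => D (line s)) by apply: (polyfun_comp algU hline hD).
have G1nz : G1 0 != 0 by rewrite -e1 line0 // mulf_neq0 // expf_neq0.
have G2nz : G2 1 != 0 by rewrite -e2 line1 // mulf_neq0 // expf_neq0.
have Dnz : D (line 0) != 0 by rewrite line0.
have [s nzs] := upolyfun_nonzero_ex hG1 hG2 G1nz G2nz.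
have [{nzs} s] := upolyfun_nonzero_ex hDl (fun_algebraM algU hG1 hG2) Dnz nzs.
rewrite !mulf_eq0 !negb_or => /and3P[Ds].
rewrite -e1 // -e2 // !mulf_eq0 !negb_or => /andP[/eqP n1 _] /andP[/eqP n2 _].
have : zclosure (param_image D phi) (phi (line s)).
  by apply: sub_zclosure; exists (line s).
by case/cover => [/v1|/v2].
Qed.

Lemma mx_eval_comp m (Q : {mpoly K[m]}) (f : 'I_m -> {mpoly K[n * n]}) :
  exists q : {mpoly K[n * n]},
    forall A, mx_eval q A = Q.@[fun i => mx_eval (f i) A].
Proof.
exists (Q \mPo [tuple f i | i < m]) => A; rewrite /mx_eval comp_mpoly_meval.
by apply: meval_eq => i; rewrite tnth_mktuple.
Qed.

Lemma param_image_dependent r (D : 'rV[K]_r -> K) phi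
    (f : 'I_r.+1 -> {mpoly K[n * n]}) :
  polyfun D -> mx_in (localized (@polyfun K r) D) phi ->
  exists2 Q : {mpoly K[r.+1]}, Q != 0 & forall A, zclosure (param_image D phi) A ->
    Q.@[fun i => mx_eval (f i) A] = 0.
Proof.
move=> hD hphi; have algP := polyfun_algebra K r.
have [|Q Q0 hQ] := localized_dependent (f := fun i u => mx_eval (f i) (phi u)) hD.
  by move=> i; apply: fun_algebra_mx_eval => //; apply: localized_algebra.
exists Q => // A clA; have [q qE] := mx_eval_comp Q f.
by rewrite -qE; apply: clA => _ [u Du ->]; rewrite qE; apply: hQ.
Qed.

Lemma param_image_no_chain r (D : 'rV[K]_r -> K) phi S :
  polyfun D -> mx_in (localized (@polyfun K r) D) phi ->
  zsubset S (zclosure (param_image D phi)) -> ~ zchain S r.+1.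
Proof.
move=> hD hphi sS /zchain_alg_indep[f /(alg_indepS (zclosure_sub sS)) indf].
have [Q /eqP Q0 hQ] := param_image_dependent f hD hphi.
exact/Q0/indf.
Qed.

(* The form of lowest degree of [Q] is the leading term of [Q (s z(s))] at
   [s = 0]; [v] is a point where it does not vanish. *)
Lemma lowest_form_nonzero m (Q : {mpoly K[m]}) : Q != 0 ->
  exists v : 'rV[K]_m, forall (D : K -> K) (z : 'I_m -> K -> K),
    upolyfun D -> D 0 != 0 -> (forall k, localized (@upolyfun K) D (z k)) ->
    (forall k, z k 0 = v ord0 k) ->
    ~ (forall s, D s != 0 -> Q.@[fun k => s * z k s] = 0).
Proof.
move=> Q0; have algU := upolyfun_algebra K.
pose hasdeg d := has (fun a => mdeg a == d) (msupp Q).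
have exd : exists d, hasdeg d.
  move: Q0; rewrite -msupp_eq0 /hasdeg; case: (msupp Q) => //= a s _.
  by exists (mdeg a); rewrite eqxx.
case: (ex_minnP exd) => d /hasP[a0 a0Q /eqP a0d] dmin.
pose Qd := \sum_(a <- msupp Q | mdeg a == d) Q@_a *: 'X_[a].
have Qd0 : Qd != 0.
  have e : Qd@_a0 = Q@_a0.
    rewrite [in RHS](mpolyE Q) /Qd !raddf_sum /= big_mkcond /=.
    apply: eq_bigr => b _; case: ifP => // nb; rewrite mcoeffZ mcoeffX.
    case: eqVneq => [eb|]; last by rewrite mulr0.
    by rewrite eb a0d eqxx in nb.
  by rewrite mcoeff_msupp -e in a0Q; apply: contraNneq a0Q => ->; rewrite mcoeff0.
have [v Qdv] := mpoly_nonroot Qd0; exists v => D z hD D0 hz z0 hQ.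
have algL := localized_algebra algU hD.
(* [R] collects the terms of degree above [d], divided by [s ^+ d.+1]. Thus [H] equals
   [Q(s z(s)) / s ^+ d] away from [0], and its value at [0] is that of [Qd] at [v]. *)
pose R s := \sum_(a <- msupp Q | mdeg a != d)
  Q@_a * (s ^+ (mdeg a - d).-1 * \prod_k z k s ^+ a k).
pose H s := Qd.@[z^~ s] + s * R s.
have HE s : s ^+ d * H s = Q.@[fun k => s * z k s].
  rewrite mevalE /H mulrDr /Qd raddf_sum /= !mulr_sumr [RHS](bigID (fun a => mdeg a == d)) /=.
  have mon (a : 'X_{1..m}) : \prod_k (s * z k s) ^+ a k = s ^+ mdeg a * \prod_k z k s ^+ a k.
    by rewrite mdegE -prodrXr -big_split /=; apply: eq_bigr => k _; rewrite exprMn.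
  congr (_ + _).
    apply: eq_bigr => a /eqP <-; rewrite mevalZ mevalX mon; ring.
  rewrite [LHS]big_seq_cond [RHS]big_seq_cond; apply: eq_bigr => a /andP[aQ nd].
  rewrite mon.
  have ltd : (d < mdeg a)%N.
    by rewrite ltn_neqAle eq_sym nd dmin //; apply/hasP; exists a.
  by rewrite -[in RHS](subnKC ltd) exprD exprS subnS; ring.
have [G [k [hG GE]]] : localized (@upolyfun K) D H.
  apply: fun_algebraD => //; first exact: fun_algebra_meval.
  apply: fun_algebraM => //; first by apply: localizedW => //; apply: upolyfun_id.
  apply: fun_algebra_sum => // a _; apply: fun_algebraM => //.
    exact: fun_algebra_const.
  apply: fun_algebraM => //.
    by apply: fun_algebraX => //; apply: localizedW => //; apply: upolyfun_id.
  by apply: fun_algebra_prod => // j; apply: fun_algebraX.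
have hid := upolyfun_id K.
have [s1 nz1] := upolyfun_nonzero_ex hid hD (oner_neq0 _ : id 1 != 0) D0.
(* Away from [0] the function [H] vanishes with [Q]; its numerator [G], being a polynomial, then
   vanishes at [0] as well. *)
have G0 : G 0 = 0.
  apply: (upolyfun_eq0 (fun_algebraM algU hid hD) hG nz1) => s.
  rewrite mulf_eq0 negb_or => /andP[s0 Ds]; rewrite -GE //.
  have /eqP := hQ s Ds; rewrite -HE mulf_eq0 expf_eq0 (negbTE s0) andbF /= => /eqP ->.
  by rewrite mul0r.
case/negP: Qdv; have /eqP := GE 0 D0.
rewrite G0 /H mul0r addr0 mulf_eq0 expf_eq0 (negbTE D0) andbF orbF.
by rewrite (meval_eq _ z0).
Qed.

Lemma mul_pid_widen i r (leir : (i <= r)%N) (v : 'rV[K]_i) (k : 'I_i) :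
  (v *m (pid_mx i : 'M_(i, r))) ord0 (widen_ord leir k) = v ord0 k.
Proof.
rewrite mxE (bigD1 k) //= big1 => [|l nlk]; rewrite !mxE /=.
  by rewrite eqxx ltn_ord mulr1 addr0.
by rewrite (inj_eq val_inj) (negbTE nlk) mulr0.
Qed.

(* The hypothesis says that the functions [f j] are local coordinates along
   [phi] at the origin, to first order. *)
Lemma param_image_chain r (D : 'rV[K]_r -> K) phi (f : 'I_r -> {mpoly K[n * n]}) S :
  polyfun D -> mx_in (localized (@polyfun K r) D) phi ->
  (forall u : 'rV[K]_r, exists E (z : 'I_r -> K -> K),
    [/\ upolyfun E, E 0 != 0, forall j, localized (@upolyfun K) E (z j),
        forall j, z j 0 = u ord0 j
      & forall s, E s != 0 -> D (s *: u) != 0 /\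
          forall j, mx_eval (f j) (phi (s *: u)) = s * z j s]) ->
  zsubset (param_image D phi) (zclosure S) -> zchain S r.
Proof.
move=> hD hphi coords sS.
have D0 : D 0 != 0.
  have [E [z [_ E0 _ _ /(_ 0 E0)[]]]] := coords 0.
  by rewrite scaler0.
(* [J i] embeds affine [i]-space as the first [i] coordinates; the chain consists of the closures of
   the images of these subspaces. *)
pose J i : 'M[K]_(i, r) := pid_mx i.
pose Di i := fun v : 'rV_i => D (v *m J i).
pose phii i := fun v : 'rV_i => phi (v *m J i).
have hJ i : mx_in (@polyfun K i) (fun v => v *m J i).
  apply: (mx_in_mul (polyfun_algebra K i) (A := id)).
    by move=> i0 j; rewrite ord1; apply: polyfun_coord.
  by apply: mx_in_const; apply: polyfun_algebra.
have hDi i : polyfun (Di i) by apply: (polyfun_comp (polyfun_algebra K i) (hJ i) hD).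
have hphii i : mx_in (localized (@polyfun K i) (Di i)) (phii i).
  by move=> a b; apply: (localized_comp (polyfun_algebra K i) (hJ i) (hphi a b)).
have Di0 i : Di i 0 != 0 by rewrite /Di mul0mx.
exists (fun i => zclosure (param_image (Di i) (phii i))); split.
- by move=> i _; apply: param_image_irreducible (Di0 i).
- move=> i ltir; split.
    apply: zclosure_sub => _ [v Dv ->]; apply: sub_zclosure.
    exists (v *m (pid_mx i : 'M_(i, i.+1))); rewrite /Di /phii -?mulmxA mul_pid_mx;
    by rewrite (minn_idPl (leqnSn i)) (minn_idPr (leqnSn i)).
  (* Were the inclusion not strict, a relation [Q] among the first [i.+1] functions on the smaller
     image would persist on the larger one. Restricted to the line through the point given by
     [lowest_form_nonzero], it yields a contradiction. *)
  move=> sub.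
  pose f' k := f (widen_ord ltir k).
  have [Q Q0 hQ] := param_image_dependent f' (hDi i) (hphii i).
  have [v lowv] := lowest_form_nonzero Q0.
  have [E [z [hE E0 hz z0 coord]]] := coords (v *m J i.+1).
  apply: (lowv E (fun k => z (widen_ord ltir k)) hE E0) => // [k|s Es].
    by rewrite z0 mul_pid_widen.
  have [Ds fE] := coord s Es.
  rewrite -(hQ (phi (s *: (v *m J i.+1)))); first by apply: meval_eq => k; rewrite fE.
  apply: sub; apply: sub_zclosure.
  by exists (s *: v); rewrite /Di /phii -scalemxAl.
apply: zclosure_sub => _ [v Dv ->]; apply: sS.
by exists (v *m J r).
Qed.

Lemma zdim_param r (D : 'rV[K]_r -> K) phi (f : 'I_r -> {mpoly K[n * n]}) S :
  polyfun D -> mx_in (localized (@polyfun K r) D) phi ->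
  (forall u : 'rV[K]_r, exists E (z : 'I_r -> K -> K),
    [/\ upolyfun E, E 0 != 0, forall j, localized (@upolyfun K) E (z j),
        forall j, z j 0 = u ord0 j
      & forall s, E s != 0 -> D (s *: u) != 0 /\
          forall j, mx_eval (f j) (phi (s *: u)) = s * z j s]) ->
  zsubset (param_image D phi) (zclosure S) ->
  zsubset S (zclosure (param_image D phi)) -> zdim S r.
Proof.
move=> hD hphi coords imS Sim; split; first exact: param_image_chain coords imS.
exact: param_image_no_chain Sim.
Qed.

End ParametrizedSets.

(** * Flag spaces and the orbit *)

Section LinearForms.
Variables (K : fieldType) (n : nat).

Lemma linear_form_mx_eval (g : {linear 'M[K]_n -> K^o}) (c : K) :
  exists p : {mpoly K[n * n]}, forall A, mx_eval p A = g A - c.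
Proof.
exists (\sum_i \sum_j g (delta_mx i j) *: 'X_(mxvec_index i j) - c%:MP) => A.
rewrite /mx_eval mevalB mevalC; congr (_ - _).
rewrite [A in RHS]matrix_sum_delta !raddf_sum /=; apply: eq_bigr => i _.
rewrite !raddf_sum /=; apply: eq_bigr => j _.
by rewrite mevalZ mevalXU mxvecE linearZ /= mulrC.
Qed.

Lemma fun_algebra_linear T (P : (T -> K) -> Prop) (A : T -> 'M[K]_n)
    (g : {linear 'M[K]_n -> K^o}) :
  fun_algebra P -> mx_in P A -> P (fun t => g (A t)).
Proof.
move=> algP hA; have [p pE] := linear_form_mx_eval g 0.
apply: (fun_algebra_ext algP (F := fun t => mx_eval p (A t))).
  by move=> t; rewrite pE subr0.
exact: fun_algebra_mx_eval.
Qed.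

End LinearForms.

Lemma conjmx_eq (K : fieldType) n (h x y : 'M[K]_n) :
  h \in unitmx -> y *m h = h *m x -> y = h *m x *m invmx h.
Proof. by move=> uh <-; rewrite mulmxK. Qed.

(** * Spaces of matrices shifting the flag *)

Section FlagSpaces.
Variables (K : fieldType) (d : seq nat).
Local Notation n := (nsum d).
Local Notation mx := ('M[K]_n).

Lemma maps_into_mul (A B : mx) i j k :
  maps_into d A j k -> maps_into d B i j -> maps_into d (A *m B) i k.
Proof.
move=> hA hB r c ci kr; rewrite mxE big1 // => m _.
by case: (ltnP m (psum d j)) => mj; [rewrite hA ?mul0r|rewrite hB ?mulr0].
Qed.

Definition flag_vanish k (r c : 'I_n) : bool :=
  [exists i : 'I_(size d).+1, (c < psum d i)%N && (psum d (i - k) <= r)%N].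

Definition flag_mask k (A : mx) : mx :=
  \matrix_(r, c) (if flag_vanish k r c then A r c else 0).

Lemma flag_mask_is_linear k : linear (flag_mask k).
Proof.
move=> a A B; apply/matrixP => r c; rewrite !mxE.
by case: ifP; rewrite // mulr0 addr0.
Qed.

HB.instance Definition _ k :=
  GRing.isLinear.Build K mx mx *:%R (flag_mask k) (flag_mask_is_linear k).

(** Presenting the flag conditions as a kernel gives a [{vspace}] with a dimension. Shift [0] is the
    Lie algebra [p] of [P(d)]; shift [l.+1] is [p_u^(l)]. *)
Definition flag_space k : {vspace mx} := lker (linfun (flag_mask k)).

Lemma flag_spaceP k (A : mx) :
  reflect (forall i, (i <= size d)%N -> maps_into d A i (i - k)) (A \in flag_space k).
Proof.
rewrite memv_ker lfunE /=; apply: (iffP eqP) => [e i lei r c ci ir|h].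
  have fv : flag_vanish k r c.
    by apply/existsP; exists (Ordinal (lei : (i < (size d).+1)%N)); rewrite /= ci.
  by have := congr1 (fun B : mx => B r c) e; rewrite !mxE fv.
apply/matrixP => r c; rewrite !mxE; case: ifP => // /existsP[i /andP[ci ir]].
exact: (h i (ltn_ord i)).
Qed.

Lemma flag_space_pu l A : pu d l A <-> A \in flag_space l.+1.
Proof. by split=> /flag_spaceP. Qed.

Lemma flag_space_parabolic g : parabolic d g <-> g \in unitmx /\ g \in flag_space 0.
Proof.
split=> -[ug h]; split=> //; first by apply/flag_spaceP => i; rewrite subn0; apply: h.
by move=> i lei; have /flag_spaceP/(_ i lei) := h; rewrite subn0.
Qed.

Lemma flag_space1 : 1%:M \in flag_space 0.
Proof.
apply/flag_spaceP => i _ r c; rewrite subn0 => ci ir.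
by rewrite mxE -val_eqE /= gtn_eqF // (leq_trans ci).
Qed.

Lemma flag_space_mul j k A B :
  A \in flag_space j -> B \in flag_space k -> A *m B \in flag_space (k + j).
Proof.
move=> /flag_spaceP hA /flag_spaceP hB; apply/flag_spaceP => i lei.
rewrite subnDA; apply: maps_into_mul (hB i lei); apply: hA.
exact: leq_trans (leq_subr _ _) lei.
Qed.

(** Left multiplication by [g] is an injective endomorphism of the finite-dimensional space [p],
    hence surjective, and the preimage of [1] is the inverse. *)
Lemma flag_space_inv g :
  g \in unitmx -> g \in flag_space 0 -> invmx g \in flag_space 0.
Proof.
move=> ug pg.
have sub : (linfun (mulmx g) @: flag_space 0 <= flag_space 0)%VS.
  by apply/subvP => _ /memv_imgP[A pA ->]; rewrite lfunE; apply: (flag_space_mul pg pA).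
have ker0 : (flag_space 0 :&: lker (linfun (mulmx g)) = 0)%VS.
  apply/eqP; rewrite -subv0; apply/subvP => A.
  rewrite memv_cap memv0 => /andP[_]; rewrite memv_ker lfunE /= => /eqP gA.
  by rewrite -(mulKmx ug A) gA mulmx0.
have : 1%:M \in (linfun (mulmx g) @: flag_space 0)%VS.
  suff /eqP-> : (linfun (mulmx g) @: flag_space 0 == flag_space 0)%VS by apply: flag_space1.
  by rewrite eqEdim sub limg_dim_eq ?leqnn.
case/memv_imgP => A pA; rewrite lfunE /= => e.
by rewrite -[invmx g]mulmx1 e mulKmx.
Qed.

Definition commutator (x : mx) : 'End(mx) := (linfun (mulmxr x) - linfun (mulmx x))%R.

Lemma commutatorE x A : commutator x A = A *m x - x *m A.
Proof. by rewrite /commutator add_lfunE opp_lfunE !lfunE. Qed.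

(** The space [W = [p, x]]: the image of the differential at [1] of [g |-> g x g^-1]. *)
Definition tangent_space (x : mx) : {vspace mx} := (commutator x @: flag_space 0)%VS.

Lemma tangent_space_sub l x :
  x \in flag_space l.+1 -> (tangent_space x <= flag_space l.+1)%VS.
Proof.
move=> ux; apply/subvP => _ /memv_imgP[g pg ->]; rewrite commutatorE.
apply: rpredB; first by rewrite -[l.+1]addn0; apply: flag_space_mul.
by rewrite -[l.+1]add0n; apply: flag_space_mul.
Qed.

End FlagSpaces.

(** * Dimensions of linear subspaces and of the orbit *)

Section Dimensions.
Variables (K : closedFieldType) (d : seq nat).
Local Notation n := (nsum d).
Local Notation mx := ('M[K]_n).

Lemma lincomb_polyfun r (e : 'I_r -> mx) :
  mx_in (@polyfun K r) (fun u => \sum_j u ord0 j *: e j).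
Proof.
have alg := polyfun_algebra K r.
apply: mx_in_sum => // j; apply: mx_in_scale => //; first exact: polyfun_coord.
exact: mx_in_const.
Qed.

Section VSpace.
Variable U : {vspace mx}.
Let r := \dim U.
Let phi (u : 'rV[K]_r) : mx := \sum_j u ord0 j *: (vbasis U)`_j.

Let phiE A : (exists2 u, (1 : K) != 0 & A = phi u) <-> A \in U.
Proof.
split=> [[u _ ->]|AU].
  by apply: rpred_sum => j _; apply: rpredZ; apply: vbasis_mem; rewrite mem_nth ?size_tuple.
exists (\row_j coord (vbasis U) j A); first exact: oner_neq0.
rewrite {1}(coord_vbasis AU); apply: eq_bigr => j _.
by rewrite mxE.
Qed.

Let hD : polyfun (fun _ : 'rV[K]_r => 1 : K).
Proof. exact: (fun_algebra_const (polyfun_algebra K r)). Qed.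

Let hphi : mx_in (localized (@polyfun K r) (fun=> 1)) phi.
Proof.
by apply: mx_in_localizedW; exact: lincomb_polyfun.
Qed.

(** Coordinates in a basis form a parametrization with denominator [1], and the coordinate forms
    recover the parameters exactly. *)
Lemma zdim_vspace S : (forall A, S A <-> A \in U) -> zdim S r.
Proof.
move=> SE.
have [f fE] : exists f : 'I_r -> {mpoly K[n * n]},
    forall j A, mx_eval (f j) A = coord (vbasis U) j A.
  apply: (@fin_all_exists _ _ (fun j fj => forall A, mx_eval fj A = coord (vbasis U) j A)) => j.
  have [p pE] := linear_form_mx_eval (coord (vbasis U) j) 0.
  by exists p => A; rewrite pE subr0.
apply: (zdim_param hD hphi (f := f)) => [u|A /phiE/SE|A /SE/phiE].
- have algU := upolyfun_algebra K.
  exists (fun=> 1), (fun j _ => u ord0 j); split=> //.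
  + exact: fun_algebra_const.
  + exact: oner_neq0.
  + by move=> j; apply: localizedW => //; apply: fun_algebra_const.
  move=> s _; split=> [|j]; first exact: oner_neq0.
  rewrite fE coord_sum_free ?mxE //.
  exact: basis_free (vbasisP U).
- exact: sub_zclosure.
exact: sub_zclosure.
Qed.

Lemma vspace_irreducible S : (forall A, S A <-> A \in U) -> zirreducible (zclosure S).
Proof.
move=> SE.
have [irr1 irr2 irr3] := param_image_irreducible (u0 := 0) hD hphi (oner_neq0 K).
have E A : zclosure S A <-> zclosure (param_image (fun=> 1) phi) A.
  split=> hA p hp; apply: hA => B; first by move/SE/phiE; apply: hp.
  by move=> hB; apply: hp; apply/SE/phiE.
split; first exact: zclosure_closed.
  by have [A /E] := irr2; exists A.
move=> Z1 Z2 c1 c2 cov; have [|h|h] := irr3 Z1 Z2 c1 c2.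
- by move=> A /E; apply: cov.
- by left=> A /E; apply: h.
by right=> A /E; apply: h.
Qed.

End VSpace.

Section Orbit.
Variables (l : nat) (x : mx).
Local Notation p := (flag_space K d 0).
Local Notation W := (tangent_space x).
Let r := \dim W.
Let b := vbasis W.
(* [adp] is a partial inverse of the commutator on the parabolic subalgebra, so
   that [p] is the direct sum of the centralizer of [x] and the image of [tau]. *)
Let adp : 'End(mx) := (commutator x \o projv p)%VF.
Let tau : 'End(mx) := (projv p \o adp^-1 \o adp)%VF.
(** Lifts to [p] of the basis [b] of [W] along the commutator; they span the complement [L] of the
    centralizer. *)
Let e (j : 'I_r) : mx := projv p ((adp^-1)%VF b`_j).

Let limg_adp : limg adp = W.
Proof. by rewrite limg_comp limg_proj. Qed.

Let e_p j : e j \in p.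
Proof. exact: memv_proj. Qed.

Let adpE A : A \in p -> adp A = commutator x A.
Proof. by move=> pA; rewrite comp_lfunE /= projv_id. Qed.

Let commutator_e j : commutator x (e j) = b`_j.
Proof.
have bW : b`_j \in limg adp.
  by rewrite limg_adp; apply: vbasis_mem; rewrite mem_nth ?size_tuple.
by rewrite -[RHS](limg_lfunVK bW) /adp comp_lfunE.
Qed.

Let tauE A : tau A = projv p ((adp^-1)%VF (adp A)).
Proof. by rewrite /tau comp_lfunE [LHS]comp_lfunE. Qed.

Let tau_p A : tau A \in p.
Proof. by rewrite tauE; apply: memv_proj. Qed.

Let commutator_tau A : A \in p -> commutator x (tau A) = commutator x A.
Proof.
move=> pA; rewrite -(adpE pA) -[RHS](limg_lfunVK (memv_img adp (memvf A))).
by rewrite tauE [RHS]comp_lfunE.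
Qed.

Let tau_span A : exists u : 'rV[K]_r, tau A = \sum_j u ord0 j *: e j.
Proof.
exists (\row_j coord b j (adp A)).
have WA : adp A \in W by rewrite -limg_adp memv_img ?memvf.
rewrite tauE {1}(coord_vbasis WA) !linear_sum.
by apply: eq_bigr => j _; rewrite !linearZ mxE.
Qed.

Let h (u : 'rV[K]_r) : mx := 1%:M + \sum_j u ord0 j *: e j.
Let D u := \det (h u).
Let phi u := h u *m x *m invmx (h u).

Let hh : mx_in (@polyfun K r) h.
Proof.
apply: mx_in_add; [exact: polyfun_algebra| |exact: lincomb_polyfun].
by apply: mx_in_const; apply: polyfun_algebra.
Qed.

Let hD : polyfun D.
Proof. by apply: fun_algebra_det => //; apply: polyfun_algebra. Qed.

Let conj_localized T (P : (T -> K) -> Prop) (A : T -> mx) :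
  fun_algebra P -> mx_in P A ->
  mx_in (localized P (fun t => \det (A t))) (fun t => A t *m x *m invmx (A t)).
Proof.
move=> algP hA; have algL := localized_algebra algP (fun_algebra_det algP hA).
apply: mx_in_mul => //; last exact: mx_in_inv.
by apply: mx_in_mul => //; [apply: mx_in_localizedW|apply: mx_in_const].
Qed.

Let hphi : mx_in (localized (@polyfun K r) D) phi.
Proof. by apply: conj_localized => //; apply: polyfun_algebra. Qed.

Let image_orbit : zsubset (param_image D phi) (zclosure (Porbit d x)).
Proof.
move=> _ [u Du ->]; apply: sub_zclosure; exists (h u); split=> //.
apply/flag_space_parabolic; split; first by rewrite unitmxE unitfE.
apply: rpredD; first exact: flag_space1.
by apply: rpred_sum => j _; apply: rpredZ.
Qed.

(** The equation on [c] reads [c = 1 - s (B - tau B)] with [B = (g - 1) c]. Then [c - 1] centralizes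
    [x], because [tau] preserves commutators with [x], while [(1 + s (g - 1)) c = 1 + s tau B] lies
    in [1 + L]. *)
Let orbit_line g : g \in p -> exists N : 'M[K]_(n * n), forall s (c : mx),
  mxvec c *m (1%:M + s *: N) = mxvec 1%:M ->
  [/\ c \in p, commutator x c = 0
    & exists u, (1%:M + s *: (g - 1%:M)) *m c = h u].
Proof.
move=> pg.
(* The inner [projv p] keeps the values of [T] in [p], so that the equation itself forces [c] into
   [p]. *)
pose T : 'End(mx) := ((\1 - tau) \o linfun (mulmx (g - 1%:M)) \o projv p)%VF.
exists (lin_mx T) => s c; rewrite mulmxDr mulmx1 -scalemxAr mul_vec_lin -!linearZ -linearD.
move/(can_inj mxvecK) => cE.
have TE A : T A = (g - 1%:M) *m projv p A - tau ((g - 1%:M) *m projv p A).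
  by rewrite /T comp_lfunE [LHS]comp_lfunE add_lfunE opp_lfunE id_lfunE (lfunE (mulmx _)).
have pB A : (g - 1%:M) *m projv p A \in p.
  have pg1 : g - 1%:M \in p by apply: rpredB => //; apply: flag_space1.
  exact: (flag_space_mul pg1 (memv_proj p A)).
have {}cE : c = 1%:M - s *: T c by rewrite -linearZ -cE addrK.
have pc : c \in p.
  by rewrite cE; apply: rpredB; [exact: flag_space1|apply: rpredZ; rewrite TE; apply: rpredB].
split=> //.
  rewrite cE linearB linearZ /= TE linearB /= commutator_tau // subrr scaler0 subr0.
  by rewrite commutatorE mul1mx mulmx1 subrr.
have [u uE] := tau_span ((g - 1%:M) *m c); exists (s *: u).
pose B := (g - 1%:M) *m c.
have {}cE : c = 1%:M - s *: (B - tau B) by rewrite {1}cE TE (projv_id pc).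
rewrite mulmxDl mul1mx -scalemxAl -/B {1}cE scalerBr opprB addrA subrK /h.
rewrite [tau B]uE scaler_sumr; congr (_ + _); apply: eq_bigr => j _.
by rewrite mxE scalerA.
Qed.

(** Join [1] to [g] by the line [G]. For all but finitely many [s], [G s] times an element
    centralizing [x] lies in [1 + L], so the conjugate of [x] by [G s] is in the image. A polynomial
    vanishing on the image thus vanishes at generic [s], hence at [s = 1]. *)
Let orbit_image : zsubset (Porbit d x) (zclosure (param_image D phi)).
Proof.
move=> _ [g [/flag_space_parabolic[ug pg] ->]] F hF.
have algU := upolyfun_algebra K.
have [N hN] := orbit_line pg.
pose G s : mx := 1%:M + s *: (g - 1%:M).
pose M s : 'M[K]_(n * n) := 1%:M + s *: N.
(* The adjugate in place of the inverse keeps [c] polynomial in [s]; the factor [\det (M s)] is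
   divided out when [hN] is applied. *)
pose c s : mx := vec_mx (mxvec 1%:M *m \adj (M s)).
have hG : mx_in (@upolyfun K) G by apply: line_upolyfun.
have hM : mx_in (@upolyfun K) M by apply: line_upolyfun.
have hc : mx_in (@upolyfun K) c.
  apply: (mx_in_unvec algU (A := fun s => mxvec 1%:M *m \adj (M s))).
  apply: (mx_in_mul algU (A := fun=> mxvec 1%:M)); first exact: mx_in_const.
  exact: mx_in_adj.
(* The nonvanishing of this product ensures that everything is invertible at [s]; at [s = 0] it is
   [1]. *)
have hdet : upolyfun (fun s => \det (G s) * (\det (M s) * \det (c s))).
  by do 2?[apply: fun_algebraM => //]; apply: fun_algebra_det.
have G0 : G 0 = 1%:M by rewrite /G scale0r addr0.
have M0 : M 0 = 1%:M by rewrite /M scale0r addr0.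
have c0 : c 0 = 1%:M by rewrite /c M0 adj1 mulmx1 mxvecK.
have det0 : \det (G 0) * (\det (M 0) * \det (c 0)) != 0.
  by rewrite G0 M0 c0 !det1 !mul1r oner_neq0.
have [H [k [hH HE]]] : localized (@upolyfun K) (fun s => \det (G s))
    (fun s => mx_eval F (G s *m x *m invmx (G s))).
  apply: fun_algebra_mx_eval; last exact: conj_localized.
  by apply: localized_algebra => //; apply: fun_algebra_det.
have G1 : G 1 = g by rewrite /G scale1r addrC subrK.
have dg : \det g != 0 by rewrite -unitfE -unitmxE.
have H1 : H 1 = 0.
  apply: (upolyfun_eq0 hdet hH det0) => s.
  rewrite !mulf_eq0 !negb_or => /and3P[dG dM dc].
  have [|pc cx [u uE]] := hN s ((\det (M s))^-1 *: c s).
    rewrite linearZ /= vec_mxK -scalemxAl -mulmxA mul_adj_mx mul_mx_scalar.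
    by rewrite scalerA mulVf ?scale1r.
  have uh : h u \in unitmx.
    rewrite -uE unitmx_mul unitmxZ ?unitfE ?invr_eq0 //.
    by rewrite !unitmxE !unitfE dG.
  rewrite -HE // -(_ : phi u = G s *m x *m invmx (G s)).
    by rewrite hF ?mul0r //; exists u => //; rewrite /D -unitfE -unitmxE.
  apply/esym/conjmx_eq => //; rewrite -uE -/(G s).
  move: cx; rewrite commutatorE => /subr0_eq cx.
  rewrite -!mulmxA cx (mulmxA (invmx _)) mulVmx ?mul1mx //.
  by rewrite unitmxE unitfE.
have dG1 : \det (G 1) != 0 by rewrite G1.
have /eqP := HE 1 dG1; rewrite G1 H1 mulf_eq0 expf_eq0.
by rewrite (negbTE dg) andbF orbF => /eqP.
Qed.

(** The local coordinates are those of [A - x] in the basis [b] of [W]. Along [G = 1 + s E] one has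
    [G x G^-1 - x = s [E, x] G^-1], and at [s = 0] the coordinates of [[E, x]] are the parameters
    [u]. *)
Lemma zdim_orbit : zdim (Porbit d x) r.
Proof.
have algU := upolyfun_algebra K.
have [f fE] : exists f : 'I_r -> {mpoly K[n * n]},
    forall j A, mx_eval (f j) A = coord b j (A - x).
  apply: (@fin_all_exists _ _ (fun j fj => forall A, mx_eval fj A = coord b j (A - x))) => j.
  have [q qE] := linear_form_mx_eval (coord b j) (coord b j x).
  by exists q => A; rewrite qE linearB.
apply: (zdim_param hD hphi (f := f)) => // u.
pose E := \sum_j u ord0 j *: e j; pose G s := 1%:M + s *: E.
have hG : mx_in (@upolyfun K) G by apply: line_upolyfun.
have hs s : h (s *: u) = G s.
  rewrite /h /G /E scaler_sumr; congr (_ + _); apply: eq_bigr => j _.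
  by rewrite mxE scalerA.
exists (fun s => \det (G s)), (fun j s => coord b j (commutator x E *m invmx (G s))).
have algL := localized_algebra algU (fun_algebra_det algU hG).
split.
- exact: fun_algebra_det.
- by rewrite /G scale0r addr0 det1 oner_neq0.
- move=> j; apply: (fun_algebra_linear (coord b j) algL).
  apply: (mx_in_mul algL (A := fun=> commutator x E)); first exact: mx_in_const.
  exact: mx_in_inv.
- move=> j; rewrite /G scale0r addr0 invmx1 mulmx1 /E linear_sum.
  rewrite (eq_bigr (fun j => u ord0 j *: b`_j)); last first.
    by move=> i _; rewrite linearZ /= commutator_e.
  by rewrite coord_sum_free //; apply: basis_free (vbasisP W).
move=> s dG; split=> [|j]; first by rewrite /D hs.
have uG : G s \in unitmx by rewrite unitmxE unitfE.
rewrite fE /phi hs -[s * _]linearZ /=; congr (coord b j _).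
rewrite -[X in _ - X](mulmxK uG) -mulmxBl scalemxAl; congr (_ *m _).
rewrite commutatorE /G mulmxDl mulmxDr mul1mx mulmx1 opprD addrACA subrr add0r.
by rewrite -scalemxAl -scalemxAr scalerBr.
Qed.

End Orbit.
End Dimensions.

(** * Self-extensions of M(x) *)

Section NatEntries.
Variable K : fieldType.

(* Entries indexed by [nat], vanishing outside the matrix; [mxfun] is the
   square case. *)
Definition nent a b (A : 'M[K]_(a, b)) (r c : nat) : K :=
  match (insub r : option 'I_a), (insub c : option 'I_b) with
  | Some r', Some c' => A r' c'
  | _, _ => 0
  end.

Lemma nentE a b (A : 'M[K]_(a, b)) (i : 'I_a) (j : 'I_b) : nent A i j = A i j.
Proof. by rewrite /nent !valK. Qed.

Lemma nent_row_out a b (A : 'M[K]_(a, b)) r c : (a <= r)%N -> nent A r c = 0.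
Proof. by move=> h; rewrite /nent insubF // ltnNge h. Qed.

Lemma nent_col_out a b (A : 'M[K]_(a, b)) r c : (b <= c)%N -> nent A r c = 0.
Proof. by move=> h; rewrite /nent (insubF _ (x := c)) ?ltnNge ?h //; case: insub. Qed.

Lemma nentP a b (A B : 'M[K]_(a, b)) :
  (forall r c, (r < a)%N -> (c < b)%N -> nent A r c = nent B r c) -> A = B.
Proof. by move=> h; apply/matrixP => i j; rewrite -!nentE h. Qed.

Lemma nent_lin a b (A B : 'M[K]_(a, b)) x r c :
  nent (x *: A + B) r c = x * nent A r c + nent B r c.
Proof. by rewrite /nent; case: insub => [i|]; [case: insub => [j|]|]; rewrite ?mxE ?mulr0 ?addr0. Qed.

Lemma nent0 a b r c : nent (0 : 'M[K]_(a, b)) r c = 0.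
Proof. by rewrite /nent; case: insub => [i|//]; case: insub => [j|//]; rewrite mxE. Qed.

Lemma nentB a b (A B : 'M[K]_(a, b)) r c : nent (A - B) r c = nent A r c - nent B r c.
Proof. by rewrite addrC -scaleN1r nent_lin mulN1r addrC. Qed.

Lemma nentN a b (A : 'M[K]_(a, b)) r c : nent (- A) r c = - nent A r c.
Proof. by rewrite -sub0r nentB nent0 sub0r. Qed.

Lemma nent_sum a b (I : finType) (x : I -> K) (A : I -> 'M[K]_(a, b)) r c :
  nent (\sum_k x k *: A k) r c = \sum_k x k * nent (A k) r c.
Proof.
elim/big_rec2: _ => [|k u v _ <-]; first exact: nent0.
by rewrite nent_lin.
Qed.

Lemma nent_matrix a b (F : nat -> nat -> K) r c :
  nent (\matrix_(i < a, j < b) F i j) r c = if (r < a)%N && (c < b)%N then F r c else 0.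
Proof.
case: (ltnP r a) => ra; last by rewrite nent_row_out.
case: (ltnP c b) => cb; last by rewrite nent_col_out.
by rewrite -[r]/(val (Ordinal ra)) -[c]/(val (Ordinal cb)) nentE mxE.
Qed.

(** Summing up to any [N >= m] makes products with different inner dimensions comparable term by
    term. *)
Lemma nent_mul N a m b (A : 'M[K]_(a, m)) (B : 'M[K]_(m, b)) r c : (m <= N)%N ->
  nent (A *m B) r c = \sum_(k < N) nent A r k * nent B k c.
Proof.
move=> leN.
case: (ltnP r a) => ra; last first.
  by rewrite nent_row_out // big1 // => k _; rewrite nent_row_out ?mul0r.
case: (ltnP c b) => cb; last first.
  by rewrite nent_col_out // big1 // => k _; rewrite (nent_col_out B) ?mulr0.
rewrite -[r]/(val (Ordinal ra)) -[c]/(val (Ordinal cb)) nentE mxE.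
transitivity (\sum_(k < m) nent A (Ordinal ra) k * nent B k (Ordinal cb)).
  by apply: eq_bigr => k _; rewrite !nentE.
rewrite (big_ord_widen N (fun k => nent A (Ordinal ra) k * nent B k (Ordinal cb)) leN).
rewrite big_mkcond; apply: eq_bigr => k _; case: ltnP => // mk.
by rewrite nent_col_out ?mul0r.
Qed.

(** The shape of the [alpha_i] of [Mx], with the two dimensions left free. *)
Definition incl a b : 'M[K]_(a, b) := \matrix_(r < a, c < b) ((r : nat) == c)%:R.

Lemma nent_incl a b r c :
  nent (incl a b) r c = if (r < a)%N && (c < b)%N then (r == c)%:R else 0.
Proof. by rewrite [LHS](nent_matrix _ _ (fun r c : nat => (r == c)%:R : K)). Qed.

Lemma nent_incl_mul a m b (A : 'M[K]_(m, b)) r c : (m <= a)%N ->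
  nent (incl a m *m A) r c = nent A r c.
Proof.
move=> le; case: (ltnP r m) => rm; last first.
  rewrite (nent_row_out A) // (nent_mul _ _ _ _ (leqnn m)) big1 // => k _.
  rewrite nent_incl; case: ifP => _; last by rewrite mul0r.
  by rewrite gtn_eqF ?mul0r // (leq_trans (ltn_ord k)).
rewrite (nent_mul _ _ _ _ (leqnn m)) (bigD1 (Ordinal rm)) //= big1.
  by rewrite nent_incl (leq_trans rm le) rm eqxx mul1r addr0.
move=> k nk; rewrite nent_incl; case: ifP => _; last by rewrite mul0r.
by rewrite -val_eqE /= eq_sym in nk; rewrite (negbTE nk) mul0r.
Qed.

Lemma nent_mul_incl a m b (A : 'M[K]_(a, m)) r c : (b <= m)%N ->
  nent (A *m incl m b) r c = if (c < b)%N then nent A r c else 0.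
Proof.
move=> le; case: (ltnP c b) => cb; last by rewrite nent_col_out.
have cm := leq_trans cb le.
rewrite (nent_mul _ _ _ _ (leqnn m)) (bigD1 (Ordinal cm)) //= big1.
  by rewrite nent_incl cm cb eqxx mulr1 addr0.
move=> k nk; rewrite nent_incl; case: ifP => _; last by rewrite mulr0.
by rewrite -val_eqE /= in nk; rewrite (negbTE nk) mulr0.
Qed.

(** The inclusions [alpha_i] are split injective, with the transpose as retraction. *)
Lemma incl_left_inverse a b : (b <= a)%N -> (incl a b)^T *m incl a b = 1%:M.
Proof.
move=> le; apply: nentP => r c rb cb; rewrite nent_mul_incl // cb.
rewrite -[r]/(val (Ordinal rb)) -[in LHS](_ : nat_of_ord (Ordinal (leq_trans cb le)) = c) //.
by rewrite nentE -[c]/(val (Ordinal cb)) nentE !mxE /= eq_sym.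
Qed.

End NatEntries.

(** * Cocycles and coboundaries *)

Section Cohomology.
Variables (K : fieldType) (t l : nat).
Implicit Types N M : rep K l.

(** The relations for the block triangular arrows hold on the diagonal blocks because [N] and [M]
    are representations; what remains is the upper right block. *)
Lemma cocycleP N M (f : cochain N M) : is_rep t N -> is_rep t M ->
  cocycle t f <->
  ((l.+2 <= t)%N -> rb N 1 *m ca f l.+1 + cb f 1 *m ra M l.+1 = 0) /\
  (forall i, (1 <= i)%N -> (i + l.+2 <= t)%N ->
     rb N i.+1 *m ca f (i + l.+1) + cb f i.+1 *m ra M (i + l.+1) =
     ra N i *m cb f i + ca f i *m rb M i).
Proof.
move=> [N1 N2] [M1 M2]; rewrite /cocycle /is_rep /=; split=> -[h1 h2]; split.
- move=> lt; have := h1 lt; rewrite mulmx_block.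
  by rewrite -[X in _ = X]block_mx0 => /eq_block_mx[].
- move=> i i1 it; have := h2 i i1 it; rewrite !mulmx_block.
  by case/eq_block_mx.
- move=> lt; rewrite mulmx_block; have := h1 lt => ->.
  by rewrite !mulmx0 !mul0mx !addr0 ?add0r N1 // M1 // block_mx0.
move=> i i1 it; rewrite !mulmx_block; have := h2 i i1 it => ->.
by rewrite !mulmx0 !mul0mx !addr0 ?add0r N2 // M2.
Qed.

Definition cohomologous N M (f g : cochain N M) : Prop :=
  exists h : forall i, 'M[K]_(dv N i, dv M i),
    (forall i, (1 <= i)%N -> (i.+1 <= t)%N ->
       ca f i = ca g i + (ra N i *m h i - h i.+1 *m ra M i)) /\
    (forall j, (1 <= j)%N -> (j + l.+1 <= t)%N ->
       cb f j = cb g j + (rb N j *m h (j + l.+1) - h j *m rb M j)).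

Lemma cohomologous_coboundary N M (f g : cochain N M) :
  cohomologous f g -> coboundary t g -> coboundary t f.
Proof.
move=> [h [ha hb]] [k [ka kb]]; exists (fun i => k i + h i); split.
  move=> i i1 it; rewrite ha // ka // mulmxDr mulmxDl opprD.
  by rewrite addrACA.
by move=> j j1 jt; rewrite hb // kb // mulmxDr mulmxDl opprD addrACA.
Qed.

Lemma cohomologous_lincomb N M e (c : 'I_e -> K) (f g : 'I_e -> cochain N M) :
  (forall k, cohomologous (f k) (g k)) ->
  cohomologous (lincomb c f) (lincomb c g).
Proof.
case/fin_all_exists => h hE; exists (fun i => \sum_k c k *: h k i); split=> [i i1 it|j j1 jt] /=.
  rewrite mulmx_sumr mulmx_suml -sumrB -big_split /=; apply: eq_bigr => k _.
  by rewrite (hE k).1 // scalerDr scalerBr scalemxAr scalemxAl.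
rewrite mulmx_sumr mulmx_suml -sumrB -big_split /=; apply: eq_bigr => k _.
by rewrite (hE k).2 // scalerDr scalerBr scalemxAr scalemxAl.
Qed.

End Cohomology.

(** * Self-extensions concentrated on the arrows [beta_j] *)

Section SelfExtensions.
Variables (K : fieldType) (d : seq nat) (l : nat) (x : 'M[K]_(nsum d)).
Local Notation n := (nsum d).
Local Notation mx := ('M[K]_n).
Local Notation t := (size d).
Local Notation M := (Mx l d x).
Hypothesis ltlt : (l < t)%N.
Hypothesis xU : x \in flag_space K d l.+1.

Lemma psum_mono i j : (i <= j)%N -> (psum d i <= psum d j)%N.
Proof.
move=> le; rewrite /psum -!(big_mkord predT (nth 0%N d)).
by rewrite [X in (_ <= X)%N](big_cat_nat (n := i)) //= leq_addr.
Qed.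

Lemma psum0 : psum d 0 = 0%N. Proof. by rewrite /psum big_ord0. Qed.

Lemma flag_space_nent k y i r c : y \in flag_space K d k -> (i <= t)%N ->
  (c < psum d i)%N -> (psum d (i - k) <= r)%N -> nent y r c = 0.
Proof.
move=> /flag_spaceP hy it ci ir.
case: (ltnP r n) => rn; last by rewrite nent_row_out.
case: (ltnP c n) => cn; last by rewrite nent_col_out.
rewrite -[r]/(val (Ordinal rn)) -[c]/(val (Ordinal cn)) nentE.
exact: (hy i it (Ordinal rn) (Ordinal cn)).
Qed.

Lemma nent_rb (y : mx) j r c :
  nent (rb (Mx l d y) j) r c =
  if (r < psum d j)%N && (c < psum d (j + l.+1))%N then nent y r c else 0.
Proof. exact: (nent_matrix _ _ (mxfun y)). Qed.

(** Stated for every [y] because, for a cochain with zero [alpha] part, the cocycle conditions are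
    these same relations. *)
Lemma Mx_is_rep y : y \in flag_space K d l.+1 -> is_rep t (Mx l d y).
Proof.
move=> yU; split=> [lt|i i1 it]; apply: nentP => r c _ cb.
  rewrite nent0 [LHS](nent_mul_incl (rb (Mx l d y) 1)) ?psum_mono //.
  case: ifP => // cl; rewrite nent_rb; case: ifP => // _.
  by apply: (flag_space_nent yU (ltnW lt) cl); rewrite subnn psum0.
rewrite [LHS](nent_mul_incl (rb (Mx l d y) i.+1)) ?psum_mono //.
rewrite [RHS](nent_incl_mul (rb (Mx l d y) i)) ?psum_mono //.
rewrite cb !nent_rb cb andbT.
have -> : (c < psum d (i.+1 + l.+1))%N.
  by apply: leq_trans cb _; rewrite psum_mono // addSn.
rewrite andbT; case: (ltnP r (psum d i)) => ri.
  by rewrite (leq_trans ri) // psum_mono.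
case: ifP => // _; apply: (flag_space_nent yU _ cb); last by rewrite addnK.
by apply: ltnW; rewrite -addnS.
Qed.

Definition beta_cochain (y : mx) : cochain M M :=
  @Cochain K l M M (fun i => 0) (fun j => rb (Mx l d y) j).

Lemma nent_beta_cochain y j r c :
  nent (cb (beta_cochain y) j) r c =
  if (r < psum d j)%N && (c < psum d (j + l.+1))%N then nent y r c else 0.
Proof. apply (nent_rb y j r c). Qed.

Lemma beta_cochain_cocycle y : y \in flag_space K d l.+1 -> cocycle t (beta_cochain y).
Proof.
move=> yU; have [y1 y2] := Mx_is_rep yU.
apply/cocycleP; try exact: Mx_is_rep.
split=> [lt|i i1 it] /=; first by rewrite mulmx0 add0r; apply: y1.
by rewrite mulmx0 mul0mx add0r addr0; apply: y2.
Qed.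

Lemma beta_cochain_lincomb e (c : 'I_e -> K) (y : 'I_e -> mx) :
  coboundary t (lincomb c (fun k => beta_cochain (y k))) <->
  coboundary t (beta_cochain (\sum_k c k *: y k)).
Proof.
have cbE j : cb (lincomb c (fun k => beta_cochain (y k))) j =
             cb (beta_cochain (\sum_k c k *: y k)) j.
  apply: nentP => r k rj kj; rewrite /= nent_sum nent_rb rj kj nent_sum.
  by apply: eq_bigr => i _; rewrite nent_rb rj kj.
have caE i : ca (lincomb c (fun k => beta_cochain (y k))) i = 0.
  by rewrite /= big1 // => k _; rewrite scaler0.
split=> -[h [ha hb]]; exists h; split=> [i i1 it|j j1 jt].
- by rewrite -ha // caE.
- by rewrite -cbE hb.
- by rewrite caE -ha.
by rewrite cbE hb.
Qed.

(** The restrictions of [-g] to the [V_i] have boundary [[g, x]]; the [alpha] part vanishes because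
    [g] preserves the flag. *)
Lemma tangent_coboundary y :
  y \in tangent_space x -> coboundary t (beta_cochain y).
Proof.
case/memv_imgP => g gp ->.
exists (fun i => - \matrix_(r < psum d i, c < psum d i) nent g r c); split=> [i i1 it|j j1 jt].
  apply/esym/eqP; rewrite subr_eq0; apply/eqP/nentP => r c ri ci /=.
  rewrite [LHS](nent_incl_mul (- _)) ?psum_mono // [RHS](nent_mul_incl (- _)) ?psum_mono //.
  rewrite ci !nentN !nent_matrix ci ri andbT (leq_trans ci) ?psum_mono //=.
  case: ltnP => // ri'; congr (- _); apply/esym.
  by apply: (flag_space_nent gp (ltnW it) ci); rewrite subn0.
apply: nentP => r c rj cj; rewrite nent_beta_cochain rj cj commutatorE.
rewrite !nentB !(nent_mul (N := n)) ?psum_mono //; last by apply: leq_trans jt; apply: leq_addr.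
rewrite addrC -!sumrN -!big_split /=; apply: eq_bigr => k _.
rewrite !nent_rb !nentN !nent_matrix rj cj !andbT /= mulrN mulNr opprK addrC.
rewrite [RHS]addrC; congr (_ - _).
  case: (ltnP k (psum d j)) => kj //; rewrite (flag_space_nent xU jt cj) ?mulr0 ?mul0r //.
  by rewrite addnK.
case: (ltnP k (psum d (j + l.+1))) => kj //.
by rewrite (flag_space_nent gp jt cj) ?mulr0 ?subn0.
Qed.

(** The vanishing [alpha] part makes each [h i.+1] extend [h i], so all are restrictions of [h t],
    which therefore preserves the flag. The equation at the last [beta] then says [y =
    [- h t, x]]. *)
Lemma coboundary_tangent y : y \in flag_space K d l.+1 ->
  coboundary t (beta_cochain y) -> y \in tangent_space x.
Proof.
move=> yU [h [ha hb]].
have step i r c : (1 <= i)%N -> (i < t)%N -> (c < psum d i)%N ->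
    nent (h i.+1) r c = nent (h i) r c.
  move=> i1 it ci; have /esym/eqP := ha i i1 it; rewrite subr_eq0 => /eqP e.
  have := congr1 (fun A => nent A r c) e.
  rewrite [X in X = _ -> _](nent_incl_mul (h i)) ?psum_mono //.
  by rewrite [X in _ = X -> _](nent_mul_incl (h i.+1)) ?psum_mono // ci.
have hT i r c : (1 <= i)%N -> (i <= t)%N -> (c < psum d i)%N ->
    nent (h t) r c = nent (h i) r c.
  move=> i1 it ci.
  suff H m : (m <= t - i)%N -> nent (h (i + m)%N) r c = nent (h i) r c.
    by have := H _ (leqnn _); rewrite subnKC.
  elim: m => [|m IH] lem; first by rewrite addn0.
  rewrite addnS step ?IH ?addn_gt0 ?i1 //.
  - exact: ltnW.
  - by rewrite -(subnKC it) ltn_add2l.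
  by apply: leq_trans ci _; rewrite psum_mono // leq_addr.
pose g : mx := h t.
have gp : g \in flag_space K d 0.
  apply/flag_spaceP => -[|i] it r c; rewrite subn0; first by rewrite psum0.
  by move=> ci ir; rewrite -nentE /g (hT i.+1) // nent_row_out.
have -> : y = commutator x (- g); last by rewrite memv_img // memvN.
(* [T] is the last index of a [beta], whose source is all of [k^n]. Rows beyond [V_T] vanish on both
   sides, and a row inside it forces [T >= 1]. *)
apply: nentP => r c rn cn; pose T := (t - l.+1)%N.
have Tt : (T + l.+1 = t)%N by rewrite subnK.
have ct : (c < psum d t)%N by [].
have comU : commutator x (- g) \in flag_space K d l.+1.
  by have /subvP := tangent_space_sub xU; apply; rewrite memv_img // memvN.
case: (ltnP r (psum d T)) => rT; last first.
  by rewrite (flag_space_nent yU (leqnn t) ct rT) (flag_space_nent comU (leqnn t) ct rT).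
have T1 : (1 <= T)%N by case: (T) rT => //; rewrite psum0.
have cT : (c < psum d (T + l.+1))%N by rewrite Tt.
have := congr1 (fun A => nent A r c) (hb T T1 (eq_leq Tt)).
rewrite nent_beta_cochain rT cT andbT => ->.
have -> : commutator x (- g) = x *m g - g *m x.
  by rewrite commutatorE mulNmx mulmxN opprK addrC.
rewrite nentB [RHS]nentB.
have leTn : (psum d T <= n)%N by rewrite psum_mono // leq_subr.
rewrite !(nent_mul (N := n)) //; last by rewrite psum_mono // Tt.
congr (_ - _); apply: eq_bigr => k _.
  have kT : (k < psum d (T + l.+1))%N by rewrite Tt; apply: ltn_ord.
  rewrite nent_rb rT kT /=; congr (_ * _); apply/esym/hT => //; last by rewrite Tt.
  by rewrite addn_gt0 T1.
rewrite nent_rb cT andbT; case: (ltnP k (psum d T)) => kT.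
  by rewrite -(hT T) // leq_subr.
rewrite mulr0 (flag_space_nent xU (leqnn t) (i := t)) ?mulr0 //.
Qed.

(** With [ra], [ra2], [rb], [rb'] standing for [alpha_i], [alpha_(i+l+1)], [beta_i], [beta_(i+1)]:
    once the [alpha] part is a boundary, subtracting that boundary leaves a [beta] part commuting
    with the inclusions. *)
Lemma twist_relation a a' b b' (ra : 'M[K]_(a', a)) (ra2 : 'M[K]_(b', b))
    (rb : 'M[K]_(a, b)) (rb' : 'M[K]_(a', b')) (cb : 'M[K]_(a, b)) (cb' : 'M[K]_(a', b'))
    (h : 'M[K]_a) (h' : 'M[K]_a') (k : 'M[K]_b) (k' : 'M[K]_b') :
  rb' *m ra2 = ra *m rb ->
  rb' *m (ra2 *m k - k' *m ra2) + cb' *m ra2 = ra *m cb + (ra *m h - h' *m ra) *m rb ->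
  (cb' - (rb' *m k' - h' *m rb')) *m ra2 = ra *m (cb - (rb *m k - h *m rb)).
Proof.
move=> e; rewrite !mulmxBr !mulmxBl !mulmxA e -!mulmxA e !mulmxA => e2.
have -> : cb' *m ra2 = ra *m cb + (ra *m h *m rb - h' *m ra *m rb) -
    (ra *m rb *m k - rb' *m k' *m ra2) by rewrite -e2 addrC addKr.
by apply/matrixP => i j; rewrite !mxE; ring.
Qed.

(** Subtracting a boundary kills the [alpha] part; the remaining [B j] extend one another, so they
    are all restrictions of the last one, which provides [y]. *)
Lemma cocycle_beta_cochain f : cocycle t f ->
  exists2 y, y \in flag_space K d l.+1 & cohomologous t f (beta_cochain y).
Proof.
have xrep := Mx_is_rep xU; case/(cocycleP f xrep xrep) => f1 f2.
pose al i : 'M[K]_(psum d i.+1, psum d i) := ra M i.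
(* The recursion solves [h i.+1 *m al i = al i *m h i - ca f i] by means of the retraction of
   [al i]. *)
pose h : forall i, 'M[K]_(psum d i) := nat_rect (fun i => 'M[K]_(psum d i)) 0
  (fun i hi => (al i *m hi - ca f i) *m (al i)^T).
have caE i : ca f i = ra M i *m h i - h i.+1 *m ra M i.
  have -> : h i.+1 *m ra M i = al i *m h i - ca f i.
    by rewrite /= -mulmxA incl_left_inverse ?mulmx1 // psum_mono.
  by rewrite opprB addrC subrK.
pose B j := cb f j - (rb M j *m h (j + l.+1)%N - h j *m rb M j).
have B1 r c : (l.+2 <= t)%N -> (c < psum d l.+1)%N -> nent (B 1%N) r c = 0.
  move=> lt cl.
  have e : B 1%N *m ra M l.+1 = 0.
    have := f1 lt; rewrite caE mulmxBr mulmxA xrep.1 // mul0mx sub0r addrC => /subr0_eq e.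
    rewrite /B mulmxBl e mulmxBl -[h 1%N *m _ *m _]mulmxA xrep.1 // mulmx0 subr0.
    by rewrite mulmxA subrr.
  have := congr1 (fun A => nent A r c) e; rewrite nent0.
  by rewrite [X in X = _ -> _](nent_mul_incl (B 1%N)) ?psum_mono // cl.
have BS i r c : (1 <= i)%N -> (i + l.+2 <= t)%N -> (c < psum d (i + l.+1))%N ->
    nent (B i.+1) r c = nent (B i) r c.
  move=> i1 it ci.
  have e : B i.+1 *m ra M (i + l.+1)%N = ra M i *m B i.
    apply: twist_relation (xrep.2 i i1 it) _.
    by have := f2 i i1 it; rewrite !caE.
  have := congr1 (fun A => nent A r c) e.
  rewrite [X in X = _ -> _](nent_mul_incl (B i.+1)) ?psum_mono // ci.
  by rewrite [X in _ = X -> _](nent_incl_mul (B i)) ?psum_mono.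
pose T := (t - l.+1)%N; have Tt : (T + l.+1 = t)%N by rewrite subnK.
have BT j r c : (1 <= j)%N -> (j <= T)%N -> (c < psum d (j + l.+1))%N ->
    nent (B T) r c = nent (B j) r c.
  move=> j1 jT cj.
  suff H m : (m <= T - j)%N -> nent (B (j + m)%N) r c = nent (B j) r c.
    by have := H _ (leqnn _); rewrite subnKC.
  elim: m => [|m IH] lem; first by rewrite addn0.
  rewrite addnS BS ?IH ?addn_gt0 ?j1 //.
  - exact: ltnW.
  - by rewrite -Tt addnS -addSn leq_add2r -(subnKC jT) ltn_add2l.
  by apply: leq_trans cj _; rewrite psum_mono // leq_add2r leq_addr.
(* When [T = 0] there is no [beta], and index [0] carries only junk. *)
pose y : mx := \matrix_(r < n, c < n) if T == 0%N then 0 else nent (B T) r c.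
have yE r c : (r < n)%N -> (c < n)%N -> (0 < T)%N -> nent y r c = nent (B T) r c.
  move=> rn cn T0; rewrite (nent_matrix _ _ (fun r c => if T == 0%N then 0 else nent (B T) r c)).
  by rewrite rn cn gtn_eqF.
exists y.
  apply/flag_spaceP => i it r c ci ir; rewrite mxE; case: eqP => // /eqP.
  (* On [V_i] with [i <= l.+1], [y] agrees with [B 1], which vanishes there; for larger [i] it
     agrees with [B (i - l.+1)], whose target is the required space. *)
  rewrite -lt0n => T0; case: (leqP i l.+1) => il.
    have cl : (c < psum d l.+1)%N by apply: leq_trans ci _; rewrite psum_mono.
    rewrite (BT 1%N) // ?B1 //; first by rewrite -Tt -addn1 addnC leq_add2r.
    by apply: leq_trans cl _; rewrite psum_mono // leq_addl.
  have i0 : (0 < i - l.+1)%N by rewrite subn_gt0.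
  rewrite (BT (i - l.+1)%N) //; first by rewrite nent_row_out.
    by rewrite leq_sub2r.
  by rewrite subnK // ltnW.
exists h; split=> [i i1 it|j j1 jt]; first by rewrite [ca (beta_cochain y) i]/(0) add0r.
have -> : cb (beta_cochain y) j = B j; last by rewrite /B subrK.
apply: nentP => r c rj cj.
have jT : (j <= T)%N by rewrite -(leq_add2r l.+1) Tt.
rewrite nent_beta_cochain rj cj yE ?(BT j) //.
- by apply: leq_trans rj _; rewrite psum_mono // (leq_trans (leq_addr l.+1 j)).
- by apply: leq_trans cj _; rewrite psum_mono.
exact: leq_trans jT.
Qed.

(** A basis of a complement [V] of [W] in [U] yields independent classes, and any larger family
    becomes dependent after projection to [V]. *)
Lemma ext1_dim_tangent :
  ext1_dim t M M (\dim (flag_space K d l.+1) - \dim (tangent_space x)).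
Proof.
pose U := flag_space K d l.+1; pose W := tangent_space x; pose V := (U :\: W)%VS.
have WU : (W <= U)%VS := tangent_space_sub xU.
have -> : (\dim U - \dim W = \dim V)%N.
  by rewrite -(dimv_cap_compl U W) (capv_idPr WU) addKn.
split.
  exists (fun k => beta_cochain (vbasis V)`_k); split=> [k|c].
    apply: beta_cochain_cocycle; apply: (subvP (diffvSl U W)).
    by apply: vbasis_mem; rewrite mem_nth ?size_tuple.
  set s := \sum_k c k *: (vbasis V)`_k.
  have sV : s \in V.
    apply: rpred_sum => k _; apply: rpredZ.
    by apply: vbasis_mem; rewrite mem_nth ?size_tuple.
  move/beta_cochain_lincomb/coboundary_tangent => sW.
  have {}sW : s \in W by apply: sW; apply: (subvP (diffvSl U W)).
  have : s \in (V :&: W)%VS by rewrite memv_cap sV.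
  rewrite capv_diff memv0 => /eqP s0.
  by apply/freeP: s0; apply: basis_free (vbasisP V).
move=> f /(fun h k => cocycle_beta_cochain (h k)) hf.
have {hf} /fin_all_exists[y hy] : forall k, exists y, y \in U /\ cohomologous t (f k) (beta_cochain y).
  by move=> k; have [y] := hf k; exists y.
(* The combination [c] cancels the [V]-components of the [y k]; what is left lies in [W], hence is a
   coboundary. *)
have [|c c0 cE] := @wide_system_ker K _ _
    (fun k j => coord (vbasis V) j (addv_pi1 U W (y k))).
  by rewrite !card_ord.
exists c; split=> //.
apply: (cohomologous_coboundary (g := lincomb c (fun k => beta_cochain (y k)))).
  by apply: cohomologous_lincomb => k; case: (hy k).
apply/beta_cochain_lincomb/tangent_coboundary.
rewrite (_ : \sum_k _ = \sum_k c k *: addv_pi2 U W (y k)).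
  by apply: rpred_sum => k _; apply: rpredZ; apply: memv_pi2.
apply/eqP; rewrite -subr_eq0 -sumrB; apply/eqP.
transitivity (\sum_k c k *: addv_pi1 U W (y k)).
  apply: eq_bigr => k _; rewrite -scalerBr -{1}(@addv_pi1_pi2 _ _ U W (y k)) ?addrK //.
  by apply: (subvP (addvSl U W)); case: (hy k).
set s1 := \sum_k _.
have s1V : s1 \in V by apply: rpred_sum => k _; apply: rpredZ; apply: memv_pi.
rewrite (coord_vbasis s1V) big1 // => j _; rewrite /s1 linear_sum /=.
rewrite (eq_bigr (fun k => c k * coord (vbasis V) j (addv_pi1 U W (y k)))).
  by rewrite cE scale0r.
by move=> k _; rewrite linearZ.
Qed.

End SelfExtensions.

(** * Codimension of the orbit *)

Lemma zchain_leq (K : fieldType) n (S : 'M[K]_n -> Prop) m m' :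
  (m <= m')%N -> zchain S m' -> zchain S m.
Proof.
move=> le [c [irr lt top]]; exists c; split=> [i im|i im|].
- by apply: irr; apply: leq_trans le.
- by apply: lt; apply: leq_trans le.
elim: m' le {irr} lt top => [|m' IH] le lt top; first by move: le; rewrite leqn0 => /eqP->.
move: le; rewrite leq_eqVlt => /predU1P[->//|le].
apply: IH => // [i im|A cA]; first by apply: lt; apply: ltnW.
by apply: top; apply: (lt m' (ltnSn m')).1.
Qed.

Lemma zchain_sub (K : closedFieldType) n (S S' : 'M[K]_n -> Prop) m :
  zsubset S (zclosure S') -> zchain S m -> zchain S' m.
Proof.
move=> sS [c [irr lt top]]; exists c; split=> // A /top.
exact: (zclosure_sub sS).
Qed.

(** For [e > 0] there is a cocycle none of whose nonzero multiples is a coboundary, whereas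
    dimension [0] provides such a multiple. *)
Lemma ext1_dim0_eq (K : fieldType) t l (M N : rep K l) e :
  ext1_dim t M N e -> ext1_dim t M N 0 -> e = 0%N.
Proof.
case: e => // e [[f [cocf indf]] _] [_ /(_ (fun=> f ord0) (fun=> cocf ord0))[c [[k ck] cob]]].
case/eqP: ck; rewrite (ord1 k).
have := indf (fun k => if k == ord0 then c ord0 else 0).
move/(_ _ ord0) => /= -> //; move: cob => [h [ha hb]].
by exists h; split=> [i i1 it|j j1 jt]; [rewrite -ha //|rewrite -hb //];
  rewrite /= [RHS]big_ord_recl big_ord0 addr0 [LHS]big_ord_recl big1 ?addr0 // => i0 _;
  rewrite scale0r.
Qed.

Theorem theorem3p1 (K : closedFieldType) (d : seq nat) (l : nat)
    (x : 'M[K]_(nsum d)) :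
  (l < size d)%N -> pu d l x ->
  (exists m1 m2 e : nat,
     [/\ zdim (@pu K d l) m1, zdim (@Porbit K d x) m2,
         ext1_dim (size d) (Mx l d x) (Mx l d x) e & (m2 + e)%N = m1]) /\
  (zdense (@Porbit K d x) (@pu K d l) <-> ext1_dim (size d) (Mx l d x) (Mx l d x) 0).
Proof.
move=> ltl /flag_space_pu xU.
have dimP := zdim_vspace (@flag_space_pu K d l).
have dimO := zdim_orbit x.
have dimE := ext1_dim_tangent ltl xU.
have leWU := dimvS (tangent_space_sub xU).
have orbitU : zsubset (Porbit d x) (pu d l).
  move=> _ [g [/flag_space_parabolic[ug pg] ->]]; apply/flag_space_pu.
  have gxU : g *m x \in flag_space K d l.+1.
    by rewrite -[l.+1]addn0; apply: flag_space_mul.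
  by rewrite -[l.+1]add0n; apply: flag_space_mul => //; apply: flag_space_inv.
split.
  exists (\dim (flag_space K d l.+1)), (\dim (tangent_space x)).
  exists (\dim (flag_space K d l.+1) - \dim (tangent_space x))%N.
  by split; rewrite ?subnKC.
split=> [dense|/(ext1_dim0_eq dimE)/eqP].
  suff leUW : (\dim (flag_space K d l.+1) <= \dim (tangent_space x))%N.
    by move: dimE; rewrite (eqP leUW).
  (* By density a chain for [p_u^(l)] is also a chain for the orbit, and it would be too long. *)
  rewrite leqNgt; apply/negP => lt; apply: dimO.2.
  by apply: (zchain_leq lt); apply: zchain_sub dense dimP.1.
rewrite subn_eq0 => leUW A UA p pO; apply/eqP/negPn/negP => /eqP pA.
have eUW : \dim (tangent_space x) = \dim (flag_space K d l.+1).
  by apply/eqP; rewrite eqn_leq leWU leUW.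
case: dimP.2; have [[c [irr lt top]] _] := dimO; rewrite eUW in irr lt top.
set m := \dim _ in irr lt top *.
have topU : zsubset (c m) (zclosure (pu d l)).
  by move=> B /top; apply: zclosure_sub => C /orbitU; apply: sub_zclosure.
(* A chain of length [m] for the orbit is prolonged by the closure of [p_u^(l)]; the last inclusion
   is strict because [p] vanishes on the orbit but not at [A]. Its length exceeds the dimension of
   [p_u^(l)]. *)
exists (fun i => if (i <= m)%N then c i else zclosure (pu d l)).
split=> [i _|i im1|]; last by rewrite ltnn.
  by case: ifP => [/irr //|_]; apply: (vspace_irreducible (@flag_space_pu K d l)).
have /predU1P[->|im] : (i == m) || (i < m)%N by rewrite -leq_eqVlt.
  rewrite leqnn ltnn; split=> // sub; apply: pA.
  by apply: (top A) pO; apply: sub; apply: sub_zclosure.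
by rewrite im (ltnW im); apply: lt.
Qed.
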